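(* Let $n_t,n_r\in\mathbb{N}$, let $\mathcal{X}\subset\mathbb{R}^{n_t}$ be a convex and compact set containing the origin, and let $\mathsf{H}\in\mathbb{R}^{n_r\times n_t}$ be any fixed matrix. Let $\mathbf{Z}\sim\mathcal{N}(\mathbf{0},\mathsf{I}_{n_r})$ and let $\tilde{\mathbf{x}}\in\mathsf{H}\mathcal{X}$ be chosen such that $\|\tilde{\mathbf{x}}\|=r_{\mathsf{max}}(\mathsf{H}\mathcal{X})$. Then $$C(\mathcal{X},\mathsf{H})\le \bar{C}_{\mathsf{M}}(\mathcal{X},\mathsf{H}):=\inf_{p>0}\; n_r\log\left(\frac{k_{n_r,p}}{(2\pi e)^{1/2}}\,n_r^{1/p}\,\|\tilde{\mathbf{x}}+\mathbf{Z}\|_p\right),$$ where, for $n\in\mathbb{N}$ and $p>0$, $$k_{n,p}:=\frac{\sqrt{\pi}\,e^{1/p}\left(\frac{p}{n}\right)^{1/p}\Gamma\left(\frac{n}{p}+1\right)^{1/n}}{\Gamma\left(\frac{n}{2}+1\right)^{1/n}}.$$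
   Context: All logarithms are to base $2$; mutual information is measured in bits. The channel is $\mathbf{Y}=\mathsf{H}\mathbf{X}+\mathbf{Z}$, where $\mathbf{Z}\sim\mathcal{N}(\mathbf{0},\mathsf{I}_{n_r})$ is independent of the input $\mathbf{X}\in\mathbb{R}^{n_t}$. The capacity is $$C(\mathcal{X},\mathsf{H}):=\max_{F_{\mathbf{X}}:\mathbf{X}\in\mathcal{X}}I(\mathbf{X};\mathsf{H}\mathbf{X}+\mathbf{Z}),$$ the maximum being over all distributions $F_{\mathbf{X}}$ of random vectors $\mathbf{X}$ taking values in $\mathcal{X}$. $\|\mathbf{x}\|$ is the Euclidean norm of a deterministic vector. For a random vector $\mathbf{U}$ in $\mathbb{R}^n$ and $p>0$, $\|\mathbf{U}\|_p$ is defined by $\|\mathbf{U}\|_p^p:=\frac1n\mathbb{E}[\|\mathbf{U}\|^p]$. $\mathsf{H}\mathcal{X}:=\{\mathsf{H}\mathbf{x}:\mathbf{x}\in\mathcal{X}\}$. For a set $\mathcal{S}\subset\mathbb{R}^n$ containing the origin, $r_{\mathsf{max}}(\mathcal{S}):=\min\{r\ge 0:\mathcal{S}\subset\mathcal{B}_{\mathbf{0}}(r)\}$, where $\mathcal{B}_{\mathbf{0}}(r)$ is the closed Euclidean ball of radius $r$ centered at the origin. *)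

(* Defs.v *)
From HB Require Import structures.
From mathcomp Require Import all_boot all_order all_algebra.
From mathcomp Require Import all_classical all_reals all_analysis.
From mathcomp Require Import measurable_realfun.

Set Implicit Arguments.
Unset Strict Implicit.
Unset Printing Implicit Defensive.

Import Order.TTheory GRing.Theory Num.Theory.
Import numFieldNormedType.Exports.

Local Open Scope classical_set_scope.
Local Open Scope ring_scope.

Definition measure_matrix_display : measure_display -> measure_display.
Proof. exact. Qed.

(* The product sigma-algebra, generated by the entries; for real matrices it
   is the Borel sigma-algebra of the library's (product) topology. *)
Section measurable_matrix.
Context {d : measure_display} {T : measurableType d} {m n : nat}.

Definition entry_preimages : set (set 'M[T]_(m, n)) :=
  [set A | exists i j, exists2 B : set T, measurable B &
     A = (fun M : 'M[T]_(m, n) => M i j) @^-1` B].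

Let matrix_set0 : <<s entry_preimages >> set0.
Proof. exact: sigma_algebra0. Qed.

Let matrix_setC A : <<s entry_preimages >> A -> <<s entry_preimages >> (~` A).
Proof. exact: sigma_algebraC. Qed.

Let matrix_bigcup (F : (set 'M[T]_(m, n))^nat) :
  (forall i, <<s entry_preimages >> (F i)) ->
  <<s entry_preimages >> (\bigcup_i (F i)).
Proof. exact: sigma_algebra_bigcup. Qed.

HB.instance Definition _ := @isMeasurable.Build (measure_matrix_display d)
  'M[T]_(m, n) <<s entry_preimages >> matrix_set0 matrix_setC matrix_bigcup.

End measurable_matrix.

Section measurable_matrix_lemmas.
Context {d d' : measure_display} {T : measurableType d} {U : measurableType d'}.
Context {m n : nat}.

Lemma measurable_entry (i : 'I_m) (j : 'I_n) :
  measurable_fun [set: 'M[T]_(m, n)] (fun M : 'M[T]_(m, n) => M i j).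
Proof.
move=> _ B mB; rewrite setTI; apply: sub_sigma_algebra.
by exists i, j, B.
Qed.

Lemma measurable_fun_matrix (f : U -> 'M[T]_(m, n)) :
  (forall i j, measurable_fun setT (fun u => f u i j)) ->
  measurable_fun setT f.
Proof.
move=> mf; apply: (@measurability _ _ _ _ _ f entry_preimages) => //.
move=> _ [_ [i [j [B mB ->]]] <-].
by have := mf i j measurableT B mB; rewrite !setTI.
Qed.

End measurable_matrix_lemmas.

Section random_pair.
Context {d d1 d2 : measure_display} {T : measurableType d}.
Context {T1 : measurableType d1} {T2 : measurableType d2}.
Variables (X : {mfun T >-> T1}) (Y : {mfun T >-> T2}).

Definition rv_pair (w : T) : T1 * T2 := (X w, Y w).

Lemma measurable_rv_pair : measurable_fun setT rv_pair.
Proof. exact: measurable_fun_pair. Qed.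

HB.instance Definition _ :=
  @isMeasurableFun.Build _ _ _ _ rv_pair measurable_rv_pair.

End random_pair.

Section channel.
Context {R : realType} {d : measure_display} {T : measurableType d}.
Context {nt nr : nat}.
Variables (H : 'M[R]_(nr, nt)).
Variables (X : {mfun T >-> 'cV[R]_nt}) (Z : {mfun T >-> 'cV[R]_nr}).

Definition channel_output (w : T) : 'cV[R]_nr := H *m X w + Z w.

Lemma measurable_channel_output : measurable_fun setT channel_output.
Proof.
apply: measurable_fun_matrix => i j.
rewrite (_ : (fun _ => _) =
  (fun w => (\sum_(k < nt) H i k * X w k j) + Z w i j)); last first.
  by apply/funext => w; rewrite !mxE.
apply: measurable_funD; last first.
  exact: (measurableT_comp (measurable_entry i j) (@measurable_funPT _ _ _ _ Z)).
apply: measurable_sum => k; apply: measurable_funM => //.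
exact: (measurableT_comp (measurable_entry k j) (@measurable_funPT _ _ _ _ X)).
Qed.

HB.instance Definition _ :=
  @isMeasurableFun.Build _ _ _ _ channel_output measurable_channel_output.

End channel.

Section information.
Context {R : realType}.
Local Open Scope ereal_scope.

Definition log2e (x : \bar R) : \bar R := lne x * ((ln 2)^-1)%:E.

(* The positive part of the integrand may have infinite integral, but its
   negative part never does, so the integral is unambiguous. *)
Definition kl_divergence {d : measure_display} {T : measurableType d}
    (P Q : probability T R) : \bar R :=
  if `[< P `<< Q >]
  then \int[P]_x log2e (Radon_Nikodym (charge_of_finite_measure P) Q x)
  else +oo.

Definition mutual_information {d d1 d2 : measure_display}
    {T : measurableType d} {T1 : measurableType d1} {T2 : measurableType d2}
    (P : probability T R) (X : {mfun T >-> T1}) (Y : {mfun T >-> T2}) :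
    \bar R :=
  kl_divergence (distribution P (rv_pair X Y))
    (distribution P X \x distribution P Y).

Definition independent_rv {d d1 d2 : measure_display}
    {T : measurableType d} {T1 : measurableType d1} {T2 : measurableType d2}
    (P : probability T R) (X : {mfun T >-> T1}) (Y : {mfun T >-> T2}) : Prop :=
  forall (A : set T1) (B : set T2), measurable A -> measurable B ->
    P (X @^-1` A `&` Y @^-1` B) = P (X @^-1` A) * P (Y @^-1` B).

(* N(0, I_n) as the law of n independent standard normal coordinates. *)
Definition standard_gaussian {d : measure_display} {T : measurableType d}
    {n : nat} (P : probability T R) (Z : {mfun T >-> 'cV[R]_n}) : Prop :=
  forall A : 'I_n -> set R, (forall i, measurable (A i)) ->
    distribution P Z [set z | forall i, A i (z i ord0)] =
    \prod_(i < n) normal_prob 0 1 (A i).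

(* Input laws are represented by random vectors with values in X, on arbitrary
   probability spaces that carry the noise. *)
Definition capacity {nt nr : nat} (X : set 'cV[R]_nt) (H : 'M[R]_(nr, nt)) :
    \bar R :=
  ereal_sup [set I | exists (d : measure_display) (T : measurableType d)
    (P : probability T R) (U : {mfun T >-> 'cV[R]_nt})
    (Z : {mfun T >-> 'cV[R]_nr}),
    [/\ forall w, X (U w), standard_gaussian P Z, independent_rv P U Z &
        I = mutual_information P U (channel_output H U Z)]].

End information.

Section moments.
Context {R : realType}.

(* The library's norm on matrices is the sup norm. *)
Definition enorm {n : nat} (x : 'cV[R]_n) : R :=
  Num.sqrt (\sum_(i < n) x i ord0 ^+ 2).

Definition rmax {n : nat} (S : set 'cV[R]_n) : R :=
  inf [set r : R | 0 <= r /\ S `<=` [set x | enorm x <= r]].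

Definition moment_norm {d : measure_display} {T : measurableType d} {n : nat}
    (P : probability T R) (p : R) (U : T -> 'cV[R]_n) : \bar R :=
  poweR ((n%:R^-1)%:E * 'E_P[fun w => (enorm (U w) `^ p)%R])%E p^-1.

Definition Gamma (x : R) : R :=
  \int[lebesgue_measure]_(t in `]0, +oo[) (t `^ (x - 1) * expR (- t)).

Definition kconst (n : nat) (p : R) : R :=
  Num.sqrt pi * expR p^-1 * (p / n%:R) `^ p^-1 *
    Gamma (n%:R / p + 1) `^ n%:R^-1 / Gamma (n%:R / 2 + 1) `^ n%:R^-1.

Definition moment_bound {d : measure_display} {T : measurableType d} {n : nat}
    (P : probability T R) (U : T -> 'cV[R]_n) : \bar R :=
  ereal_inf [set
    (n%:R%:E * log2e ((kconst n p / (2 * pi * expR 1) `^ 2^-1 *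
                         n%:R `^ p^-1)%:E * moment_norm P p U))%E
    | p in [set p : R | 0 < p]].

End moments.

(* Main.v *)
From HB Require Import structures.
Require Import Defs.
From mathcomp Require Import all_boot all_order all_algebra.
From mathcomp Require Import all_classical all_reals all_analysis.
From mathcomp Require Import measurable_realfun ring lra.
Import Order.TTheory GRing.Theory Num.Theory.
Import numFieldNormedType.Exports.
Local Open Scope classical_set_scope.
Local Open Scope ring_scope.

(** For every input, the law of [(U, Y)] has density [phi(y - H u) / f(y)] with
respect to the product of its marginals, [f] being the density of [Y].  Since
[ln t <= t - 1], replacing [f] by any other probability density [q] can only
increase the mean of the logarithm, so [I(U;Y)] is at most the mean of
[ln (phi(Y - H U) / q(Y))].  For [q = exp(-a |y|^p) / K] this is
[ln K + a E|Y|^p] minus the entropy of [Z].  The layer-cake formula and the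
homogeneity of the volume of balls give [K] in terms of Gamma, the case [p = 2]
of the same computation giving the volume of the unit ball.  Finally
[E|x + Z|^p] is a nondecreasing function of [|x|]: compare two points through
the reflection that exchanges them.  Hence [E|Y|^p <= E|xt + Z|^p =: M], and
[a = n / (p M)] yields the bound.

Lebesgue integrals on column vectors are obtained from the Gaussian law [gam]
by dividing out its density, so that only probability measures need to be
constructed. *)

Set Implicit Arguments.
Unset Strict Implicit.
Unset Printing Implicit Defensive.

(** The density [q] is taken proportional to [exp(-a |y|^p)] because its logarithm is affine in
    [|y|^p]: the output then enters only through [E|Y|^p], and such laws maximize the entropy under
    a constraint on that moment. Since [ln K] is a constant minus [(n / p) ln a], the sum
    [ln K + a M] is smallest at [a = n / (p M)].

    The entropy of [Z] enters through [E|Z|^2], for which the lower bound [n] suffices; it is read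
    off from the way Gaussian integrals scale.

    Facts about Lebesgue integrals in dimension [n] are proved by peeling off one coordinate with
    Fubini. The obstacle is the reflection, which mixes the coordinates; it is handled through
    shears, which are translations of the tail.

    The density of [Y] is finite and positive at every point, being an average of translates of
    [phi]. The divergence is therefore the integral of a real logarithm, and only the majorant of
    that logarithm is shown to be integrable. *)

Section density.
Context {d : measure_display} {T : measurableType d} {R : realType}.
Local Open Scope ereal_scope.

Lemma dominates_density (mu nu : {measure set T -> \bar R}) (h : T -> \bar R) :
  measurable_fun setT h ->
  (forall A, measurable A -> nu A = \int[mu]_(x in A) h x) -> nu `<< mu.
Proof.
move=> mh nuE; apply/null_content_dominatesP => A mA muA0.
rewrite nuE// null_set_integral//; exact: measurable_funTS.
Qed.

(** The Radon-Nikodym derivative of [nu] and [h] have the same integral over every measurable set,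
    hence agree almost everywhere, and the change of variables through the former carries over to
    [h]. *)
Lemma ge0_integral_density (mu : {sigma_finite_measure set T -> \bar R})
    (nu : {finite_measure set T -> \bar R}) (h f : T -> \bar R) :
  measurable_fun setT h -> (forall x, 0 <= h x) ->
  (forall A, measurable A -> nu A = \int[mu]_(x in A) h x) ->
  measurable_fun setT f -> (forall x, 0 <= f x) ->
  \int[nu]_x f x = \int[mu]_x (f x * h x).
Proof.
move=> mh h0 nuE mf f0.
have numu : nu `<< mu by exact: dominates_density mh nuE.
have ig := Radon_Nikodym_SigmaFinite.f_integrable numu.
rewrite -(Radon_Nikodym_SigmaFinite.change_of_variables numu f0)//.
apply: ge0_ae_eq_integral => //.
- by apply: emeasurable_funM => //; exact: measurable_int ig.
- exact: emeasurable_funM.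
- by move=> x _; rewrite mule_ge0// Radon_Nikodym_SigmaFinite.f_ge0.
- by move=> x _; rewrite mule_ge0.
apply: (filterS _ (integral_ae_eq measurableT ig mh _)) => [x /= gh _|E _ mE].
  by rewrite gh.
by rewrite -nuE// -Radon_Nikodym_SigmaFinite.f_integral.
Qed.

End density.

(** * Column vectors as head and tail, inner product, and the Gaussian law *)

Section vectors.
Context {R : realType}.

Definition dot {n} (x y : 'cV[R]_n) : R := \sum_(i < n) x i ord0 * y i ord0.

Definition vcons {n} (t : R) (y : 'cV[R]_n) : 'cV[R]_n.+1 :=
  \col_i (if unlift ord0 i is Some j then y j ord0 else t).

Lemma vcons0 n t (y : 'cV[R]_n) : vcons t y ord0 ord0 = t.
Proof. by rewrite mxE unlift_none. Qed.

Lemma vconsS n t (y : 'cV[R]_n) i : vcons t y (lift ord0 i) ord0 = y i ord0.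
Proof. by rewrite mxE liftK. Qed.

Lemma vcons_surj n (x : 'cV[R]_n.+1) :
  x = vcons (x ord0 ord0) (\col_i x (lift ord0 i) ord0).
Proof.
apply/matrixP => i j; rewrite (ord1 j).
by case: (unliftP ord0 i) => [k ->|->]; rewrite ?vconsS ?vcons0 ?mxE.
Qed.

Lemma vconsD n s t (x y : 'cV[R]_n) : vcons s x + vcons t y = vcons (s + t) (x + y).
Proof.
apply/matrixP => i j; rewrite (ord1 j) !mxE.
by case: unliftP => [k _|_]; rewrite ?mxE.
Qed.

Lemma vconsZ n c t (y : 'cV[R]_n) : c *: vcons t y = vcons (c * t) (c *: y).
Proof.
apply/matrixP => i j; rewrite (ord1 j) !mxE.
by case: unliftP => [k _|_]; rewrite ?mxE.
Qed.

Lemma dot_vcons n s t (x y : 'cV[R]_n) : dot (vcons s x) (vcons t y) = s * t + dot x y.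
Proof.
rewrite /dot big_ord_recl !vcons0; congr (_ + _).
by apply: eq_bigr => i _; rewrite !vconsS.
Qed.

Lemma dotDl n (x y z : 'cV[R]_n) : dot (x + y) z = dot x z + dot y z.
Proof. by rewrite -big_split/=; apply: eq_bigr => i _; rewrite !mxE mulrDl. Qed.

Lemma dotZl n c (x y : 'cV[R]_n) : dot (c *: x) y = c * dot x y.
Proof. by rewrite /dot mulr_sumr; apply: eq_bigr => i _; rewrite !mxE mulrA. Qed.

Lemma dotC n (x y : 'cV[R]_n) : dot x y = dot y x.
Proof. by apply: eq_bigr => i _; rewrite mulrC. Qed.

Lemma dotDr n (x y z : 'cV[R]_n) : dot x (y + z) = dot x y + dot x z.
Proof. by rewrite dotC dotDl !(dotC x). Qed.

Lemma dotZr n c (x y : 'cV[R]_n) : dot x (c *: y) = c * dot x y.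
Proof. by rewrite dotC dotZl dotC. Qed.

Lemma dotNr n (x y : 'cV[R]_n) : dot x (- y) = - dot x y.
Proof. by rewrite -scaleN1r dotZr mulN1r. Qed.

Lemma dotNl n (x y : 'cV[R]_n) : dot (- x) y = - dot x y.
Proof. by rewrite dotC dotNr dotC. Qed.

Lemma dot_ge0 n (x : 'cV[R]_n) : 0 <= dot x x.
Proof. by apply: sumr_ge0 => i _; rewrite -expr2 sqr_ge0. Qed.

Lemma dot_eq0 n (x : 'cV[R]_n) : dot x x = 0 -> x = 0.
Proof.
move=> /eqP; rewrite psumr_eq0 => [/allP x0|i _]; last by rewrite -expr2 sqr_ge0.
apply/matrixP => i j; rewrite (ord1 j) mxE.
by have := x0 i (mem_index_enum i); rewrite mulf_eq0 orbb => /eqP.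
Qed.

Lemma enormE n (x : 'cV[R]_n) : enorm x = Num.sqrt (dot x x).
Proof. by congr Num.sqrt; apply: eq_bigr => i _; rewrite expr2. Qed.

Definition vcons_pair {n} (p : measurableTypeR R * 'cV[R]_n) : 'cV[R]_n.+1 := vcons p.1 p.2.

Lemma measurable_vcons_pair n : measurable_fun setT (@vcons_pair n).
Proof.
apply: measurable_fun_matrix => i j; rewrite (ord1 j) /vcons_pair.
case: (unliftP ord0 i) => [k ->|->].
  under eq_fun do rewrite vconsS.
  exact: (measurableT_comp (measurable_entry k ord0)).
by under eq_fun do rewrite vcons0; exact: measurable_fst.
Qed.

HB.instance Definition _ n := @isMeasurableFun.Build _ _ _ _
  (@vcons_pair n) (@measurable_vcons_pair n).

Definition normal1 : probability (measurableTypeR R) R := normal_prob 0 1.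

(** Recursion on the dimension hands Fubini one coordinate at a time; the inductions on [n] below
    rest on this form. *)
Fixpoint gam (n : nat) : probability 'cV[R]_n R :=
  match n with
  | 0 => dirac (0 : 'cV[R]_0)
  | m.+1 => distribution (normal1 \x gam m)%E (@vcons_pair m)
  end.

End vectors.

(** * Measurability of the vector operations *)

Section measurability.
Context {R : realType} {d : measure_display} {T : measurableType d}.

Lemma measurable_vadd n (f g : T -> 'cV[R]_n) :
  measurable_fun setT f -> measurable_fun setT g ->
  measurable_fun setT (fun w => f w + g w).
Proof.
move=> mf mg; apply: measurable_fun_matrix => i j.
under eq_fun do rewrite mxE.
by apply: measurable_funD; exact: measurableT_comp (measurable_entry i j) _.
Qed.

Lemma measurable_vscale n (c : T -> R) (f : T -> 'cV[R]_n) :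
  measurable_fun setT c -> measurable_fun setT f ->
  measurable_fun setT (fun w => c w *: f w).
Proof.
move=> mc mf; apply: measurable_fun_matrix => i j.
under eq_fun do rewrite mxE.
by apply: measurable_funM => //; exact: measurableT_comp (measurable_entry i j) _.
Qed.

Lemma measurable_vopp n (f : T -> 'cV[R]_n) :
  measurable_fun setT f -> measurable_fun setT (fun w => - f w).
Proof.
move=> mf; under eq_fun do rewrite -scaleN1r.
exact: measurable_vscale.
Qed.

Lemma measurable_vmul m n (H : 'M[R]_(m, n)) (f : T -> 'cV[R]_n) :
  measurable_fun setT f -> measurable_fun setT (fun w => H *m f w).
Proof.
move=> mf; apply: measurable_fun_matrix => i j.
under eq_fun do rewrite mxE.
apply: measurable_sum => k; apply: measurable_funM => //.
exact: measurableT_comp (measurable_entry k j) _.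
Qed.

Lemma measurable_dot n (f g : T -> 'cV[R]_n) :
  measurable_fun setT f -> measurable_fun setT g ->
  measurable_fun setT (fun w => dot (f w) (g w)).
Proof.
move=> mf mg; apply: measurable_sum => i; apply: measurable_funM;
  exact: measurableT_comp (measurable_entry i ord0) _.
Qed.

Lemma measurable_enorm n (f : T -> 'cV[R]_n) :
  measurable_fun setT f -> measurable_fun setT (fun w => enorm (f w)).
Proof.
move=> mf; under eq_fun do rewrite enormE.
apply: measurableT_comp (measurable_dot mf mf).
exact: continuous_measurable_fun (@sqrt_continuous R).
Qed.

Lemma measurable_vcons n (c : T -> measurableTypeR R) (f : T -> 'cV[R]_n) :
  measurable_fun setT c -> measurable_fun setT f ->
  measurable_fun setT (fun w => vcons (c w) (f w)).
Proof.
move=> mc mf.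
exact: (measurableT_comp (@measurable_vcons_pair R n) (measurable_fun_pair mc mf)).
Qed.

End measurability.

Lemma measurable_vconsr {R : realType} n (t : R) :
  measurable_fun setT (vcons t : 'cV[R]_n -> 'cV[R]_n.+1).
Proof. exact: measurable_vcons. Qed.

(** * Lebesgue integration on column vectors *)

Section lebesgue.
Context {R : realType}.
Local Open Scope ereal_scope.
Notation mu := (@lebesgue_measure R).
Implicit Types n : nat.

Definition phi {n} (y : 'cV[R]_n) : R :=
  ((Num.sqrt (2 * pi)) ^- n * expR (- (dot y y / 2)))%R.

Lemma sqrt2pi_gt0 : (0 < Num.sqrt (2 * pi) :> R)%R.
Proof. by rewrite sqrtr_gt0 mulr_gt0// pi_gt0. Qed.

Lemma phi_gt0 n (y : 'cV[R]_n) : (0 < phi y)%R.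
Proof. by rewrite mulr_gt0 ?expR_gt0// invr_gt0 exprn_gt0// sqrt2pi_gt0. Qed.

Lemma phi_neq0 n (y : 'cV[R]_n) : phi y != 0%R.
Proof. by rewrite gt_eqF// phi_gt0. Qed.

Lemma phi_ge0 n (y : 'cV[R]_n) : (0 <= phi y)%R.
Proof. exact/ltW/phi_gt0. Qed.

Lemma phi_vcons n t (y : 'cV[R]_n) : phi (vcons t y) = (normal_pdf 0 1 t * phi y)%R.
Proof.
rewrite /phi dot_vcons normal_pdfE ?oner_neq0// /normal_peak /normal_fun.
rewrite expr1n mul1r subr0 exprS invfM (mulr_natl pi 2).
have -> : (- ((t * t + dot y y) / 2) = - t ^+ 2 / 2 + - (dot y y / 2))%R by field.
by rewrite expRD mulrACA.
Qed.

Lemma normal_pdf_gt0 (t : R) : (0 < normal_pdf 0 1 t)%R.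
Proof.
by rewrite normal_pdfE ?oner_neq0// mulr_gt0 ?expR_gt0// normal_peak_gt0 ?oner_neq0.
Qed.

Lemma measurable_phi n d (T : measurableType d) (f : T -> 'cV[R]_n) :
  measurable_fun setT f -> measurable_fun setT (fun w => phi (f w)).
Proof.
move=> mf; apply: measurable_funM => //; apply: measurableT_comp => //.
apply: measurableT_comp => //; apply: measurable_funM => //.
exact: measurable_dot.
Qed.

Lemma measurable_phiV n d (T : measurableType d) (f : T -> 'cV[R]_n) :
  measurable_fun setT f -> measurable_fun setT (fun w => (phi (f w))^-1%R).
Proof.
move=> mf; under eq_fun do rewrite invfM invrK -expRN opprK.
apply: measurable_funM => //; apply: measurableT_comp => //.
apply: measurable_funM => //; exact: measurable_dot.
Qed.

Definition leb {n} (f : 'cV[R]_n -> \bar R) : \bar R :=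
  \int[gam n]_y (f y * (phi y)^-1%:E).

Lemma integral_gam n (f : 'cV[R]_n -> \bar R) :
  \int[gam n]_y f y = leb (fun y => f y * (phi y)%:E).
Proof.
by apply: eq_integral => y _; rewrite -muleA -EFinM divff ?mule1// phi_neq0.
Qed.

Lemma leb_ge0 n (f : 'cV[R]_n -> \bar R) : (forall y, 0 <= f y) -> 0 <= leb f.
Proof.
by move=> f0; apply: integral_ge0 => y _; rewrite mule_ge0// lee_fin invr_ge0 phi_ge0.
Qed.

Lemma ge0_integral_normal1 (f : measurableTypeR R -> \bar R) :
  measurable_fun setT f -> (forall t, 0 <= f t) ->
  \int[normal1]_t f t = \int[mu]_t (f t * (normal_pdf 0 1 t)%:E).
Proof.
move=> mf f0; apply: ge0_integral_density => //.
- by apply/measurable_EFinP; exact: measurable_normal_pdf.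
- by move=> t; rewrite lee_fin normal_pdf_ge0.
Qed.

Lemma measurable_lebi n (f : 'cV[R]_n -> \bar R) : measurable_fun setT f ->
  measurable_fun setT (fun y => f y * (phi y)^-1%:E).
Proof.
move=> mf; apply: emeasurable_funM => //; apply/measurable_EFinP.
exact: measurable_phiV.
Qed.

(** Since [phi] is a product over head and tail, the Gaussian weight of the first coordinate cancels
    and leaves Lebesgue measure there. *)
Lemma leb_cons n (f : 'cV[R]_n.+1 -> \bar R) :
  measurable_fun setT f -> (forall y, 0 <= f y) ->
  leb f = \int[mu]_t leb (fun y => f (vcons t y)).
Proof.
move=> mf f0.
have mvc : measurable_fun setT (fun p : measurableTypeR R * 'cV[R]_n => vcons p.1 p.2).
  exact: measurable_vcons_pair.
pose g (p : measurableTypeR R * 'cV[R]_n) :=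
  f (vcons p.1 p.2) * (phi (vcons p.1 p.2))^-1%:E.
have mg : measurable_fun setT g.
  exact: (measurableT_comp (measurable_lebi mf) mvc).
have g0 p : 0 <= g p by rewrite mule_ge0// lee_fin invr_ge0 phi_ge0.
transitivity (\int[normal1 \x gam n]_p g p).
  rewrite /leb; apply: ge0_integral_distribution; first exact: measurable_lebi.
  by move=> y; rewrite mule_ge0// lee_fin invr_ge0 phi_ge0.
have -> := fubini_tonelli1 (m1 := normal1) (m2 := gam n) g mg g0.
rewrite /fubini_F ge0_integral_normal1; last 2 first.
- exact: measurable_fun_fubini_tonelli_F.
- by move=> t; exact: integral_ge0.
apply: eq_integral => t _.
rewrite -ge0_integralZr//; last 2 first.
- exact: (measurableT_comp mg (measurable_pair1 _)).
- by rewrite lee_fin normal_pdf_ge0.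
apply: eq_integral => y _.
rewrite /g/= phi_vcons -!muleA -EFinM; congr (_ * _%:E).
by rewrite invfM mulrAC mulVf ?mul1r// gt_eqF// normal_pdf_gt0.
Qed.

Lemma measurable_leb_cons n (f : 'cV[R]_n.+1 -> \bar R) :
  measurable_fun setT f -> (forall y, 0 <= f y) ->
  measurable_fun setT (fun t : measurableTypeR R => leb (fun y => f (vcons t y))).
Proof.
move=> mf f0.
pose g (p : measurableTypeR R * 'cV[R]_n) := f (vcons p.1 p.2) * (phi p.2)^-1%:E.
have mg : measurable_fun setT g.
  apply: emeasurable_funM.
    exact: (measurableT_comp mf (@measurable_vcons_pair R n)).
  by apply/measurable_EFinP/measurable_phiV.
have g0 p : 0 <= g p by rewrite mule_ge0// lee_fin invr_ge0 phi_ge0.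
exact: (measurable_fun_fubini_tonelli_F (m2 := gam n) g mg g0).
Qed.

Lemma leb_fubini n (g : measurableTypeR R * 'cV[R]_n -> \bar R) :
  measurable_fun setT g -> (forall p, 0 <= g p) ->
  \int[mu]_t leb (fun y => g (t, y)) = leb (fun y => \int[mu]_t g (t, y)).
Proof.
move=> mg g0.
pose h (p : measurableTypeR R * 'cV[R]_n) := g p * (phi p.2)^-1%:E.
have mh : measurable_fun setT h.
  by apply: emeasurable_funM => //; apply/measurable_EFinP/measurable_phiV.
have h0 p : 0 <= h p by rewrite mule_ge0// lee_fin invr_ge0 phi_ge0.
rewrite [LHS](fubini_tonelli (m1 := mu) (m2 := gam n) h mh h0).
apply: eq_integral => y _; rewrite /h/= ge0_integralZr//.
- exact: (measurableT_comp mg (measurable_pair2 _)).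
- by rewrite lee_fin invr_ge0 phi_ge0.
Qed.

(** With the first coordinate integrated innermost, a map of that coordinate may depend on the tail,
    as it does for the reflection. *)
Lemma leb_consC n (f : 'cV[R]_n.+1 -> \bar R) :
  measurable_fun setT f -> (forall y, 0 <= f y) ->
  leb f = leb (fun y => \int[mu]_t f (vcons t y)).
Proof.
move=> mf f0; rewrite (leb_cons mf f0).
exact: (leb_fubini (measurableT_comp mf (@measurable_vcons_pair R n)) (fun=> f0 _)).
Qed.

Lemma leb0 (f : 'cV[R]_0 -> \bar R) : measurable_fun setT f -> leb f = f 0%R.
Proof.
move=> mf; rewrite /leb integral_dirac//; last exact: measurable_lebi.
by rewrite diracE in_setT mul1e /phi /dot big_ord0 mul0r oppr0 expR0 expr0 invr1 mulr1 invr1 mule1.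
Qed.

End lebesgue.

(** * Affine changes of variable on the real line *)

Section lebesgue_affine.
Context {R : realType}.
Notation GR := (measurableTypeR R).
Notation mu := (@lebesgue_measure R).

Definition affine (a b : R) (t : GR) : GR := a + b * t.

Lemma measurable_affine a b : measurable_fun setT (affine a b).
Proof.
by apply: measurable_funD => //; apply: measurable_funM => //; exact: measurable_id.
Qed.

Local Open Scope ereal_scope.

Definition affine_image (a b : R) : {measure set GR -> \bar R} :=
  measure_function_pushforward__canonical__measure_function_Measure
    mu (@measurable_affine a b).

(** The right-hand side is a measure in [A], so by uniqueness of Lebesgue measure it only has to be
    computed on half-open intervals. *)
Lemma lebesgue_measure_affine (a b : R) (A : set GR) : b != 0%R -> measurable A ->
  mu A = `|b|%:E * mu (affine a b @^-1` A).
Proof.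
move=> b0 mA.
pose nb : {nonneg R} := NngNum (normr_ge0 b).
transitivity (mscale nb (affine_image a b) A); last by [].
apply: lebesgue_measure_unique => //= _ [[x y] _ <-].
rewrite /mscale/= /pushforward.
have [b_gt0|b_lt0] : (0 < b \/ b < 0)%R.
  by move: b0; rewrite neq_lt => /orP[]; [right|left].
- rewrite (_ : _ @^-1` _ = `]((x - a) / b)%R, ((y - a) / b)%R]%classic); last first.
    apply/seteqP; split => t /=; rewrite !in_itv/= /affine.
      by rewrite ltr_pdivrMr// ler_pdivlMr// ltrBlDl lerBrDl (mulrC t).
    by rewrite ltr_pdivrMr// ler_pdivlMr// ltrBlDl lerBrDl (mulrC t).
  rewrite !lebesgue_measure_itv/= !lte_fin ltr_pM2r ?invr_gt0// ltrD2r.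
  case: ifPn => _; last by rewrite mule0.
  rewrite gtr0_norm// -!EFinB -EFinM; congr _%:E.
  by field.
(* A negative slope moves the closed end to the left; the length is unaffected. *)
- rewrite (_ : _ @^-1` _ = `[((y - a) / b)%R, ((x - a) / b)%R[%classic); last first.
    apply/seteqP; split => t /=; rewrite !in_itv/= /affine.
      by rewrite ler_ndivrMr// ltr_ndivlMr// ltrBlDl lerBrDl (mulrC t) andbC.
    by rewrite ler_ndivrMr// ltr_ndivlMr// ltrBlDl lerBrDl (mulrC t) andbC.
  rewrite !lebesgue_measure_itv/= !lte_fin ltr_nM2r ?invr_lt0// ltrD2r.
  case: ifPn => _; last by rewrite mule0.
  rewrite ltr0_norm// -!EFinB -EFinM; congr _%:E.
  by field.
Qed.

Lemma ge0_integral_affine (a b : R) (f : GR -> \bar R) : b != 0%R ->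
  measurable_fun setT f -> (forall t, 0 <= f t) ->
  \int[mu]_t f t = `|b|%:E * \int[mu]_t f (affine a b t).
Proof.
move=> b0 mf f0.
pose nb : {nonneg R} := NngNum (normr_ge0 b).
transitivity (\int[mscale nb (affine_image a b)]_t f t).
  by apply: eq_measure_integral => A mA _; exact: lebesgue_measure_affine.
by rewrite ge0_integral_mscale// ge0_integral_pushforward//; exact: measurable_affine.
Qed.

End lebesgue_affine.

(** * Translations, homotheties, shears and reflections *)

Section lebesgue_invariance.
Context {R : realType}.
Local Open Scope ereal_scope.
Notation mu := (@lebesgue_measure R).

Lemma eq_leb n (f g : 'cV[R]_n -> \bar R) : f =1 g -> leb f = leb g.
Proof. by move=> fg; apply: eq_integral => y _; rewrite fg. Qed.

Lemma leb_translate n (x : 'cV[R]_n) (f : 'cV[R]_n -> \bar R) :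
  measurable_fun setT f -> (forall y, 0 <= f y) ->
  leb (fun y => f (x + y)%R) = leb f.
Proof.
have mD m (z : 'cV[R]_m) : measurable_fun setT (fun y => z + y)%R.
  exact: measurable_vadd.
elim: n x f => [|n IH] x f mf f0.
  by rewrite !leb0//; [rewrite addr0 flatmx0|exact: (measurableT_comp mf (mD _ _))].
rewrite (vcons_surj x); set a := x ord0 ord0; set b := (\col_i _)%R.
rewrite leb_cons//; last exact: (measurableT_comp mf (mD _ _)).
pose G (t : measurableTypeR R) := leb (fun y => f (vcons t y)).
transitivity (\int[mu]_t G t); last by rewrite [RHS]leb_cons.
rewrite [RHS](@ge0_integral_affine _ a 1 G)//; last 2 first.
- exact: measurable_leb_cons.
- by move=> t; exact: leb_ge0.
rewrite normr1 mul1e; apply: eq_integral => t _.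
rewrite /G /affine mul1r -(IH b (fun y => f (vcons (a + t)%R y)))//; last first.
  exact: (measurableT_comp mf (measurable_vconsr _)).
by apply: eq_leb => y; rewrite vconsD.
Qed.

Lemma leb_scale n (c : R) (f : 'cV[R]_n -> \bar R) : c != 0%R ->
  measurable_fun setT f -> (forall y, 0 <= f y) ->
  leb f = (`|c| ^+ n)%:E * leb (fun y => f (c *: y)%R).
Proof.
have mZ m : measurable_fun setT (fun y : 'cV[R]_m => c *: y)%R.
  exact: measurable_vscale.
move=> c0; elim: n f => [|n IH] f mf f0.
  rewrite !leb0//; last exact: (measurableT_comp mf (mZ _)).
  by rewrite scaler0 expr0 mul1e.
rewrite [in RHS]leb_cons//; last exact: (measurableT_comp mf (mZ _)).
pose G (t : measurableTypeR R) := leb (fun y => f (vcons t y)).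
have mG : measurable_fun setT G by exact: measurable_leb_cons.
transitivity (\int[mu]_t G t); first by rewrite leb_cons.
have G0 t : 0 <= G t by exact: leb_ge0.
rewrite (ge0_integral_affine 0 c0 mG G0) exprS EFinM -muleA; congr (_ * _).
have mfc : measurable_fun setT (fun y : 'cV[R]_n.+1 => f (c *: y)%R).
  exact: (measurableT_comp mf (mZ _)).
rewrite -ge0_integralZl; [|exact: measurableT
  |exact: (measurable_leb_cons mfc (fun y => f0 _))|..]; last 2 first.
- by move=> t _; exact: leb_ge0.
- by rewrite lee_fin exprn_ge0.
apply: eq_integral => t _.
rewrite /G (IH (fun y => f (vcons (affine 0 c t) y)))//; last first.
  exact: (measurableT_comp mf (measurable_vconsr _)).
by congr (_ * _); apply: eq_leb => y; rewrite vconsZ /affine add0r.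
Qed.

Definition shear n (b : 'cV[R]_n) (x : 'cV[R]_n.+1) : 'cV[R]_n.+1 :=
  (x + x ord0 ord0 *: vcons 0 b)%R.

Lemma shear_vcons n (b : 'cV[R]_n) t y :
  shear b (vcons t y) = vcons t (y + t *: b)%R.
Proof. by rewrite /shear vcons0 vconsZ vconsD mulr0 addr0. Qed.

Lemma measurable_shear n (b : 'cV[R]_n) : measurable_fun setT (shear b).
Proof.
apply: measurable_vadd => //; apply: measurable_vscale => //.
exact: measurable_entry.
Qed.

(** For a fixed first coordinate [t] the shear translates the tail by [t *: b]. *)
Lemma leb_shear n (b : 'cV[R]_n) (f : 'cV[R]_n.+1 -> \bar R) :
  measurable_fun setT f -> (forall y, 0 <= f y) ->
  leb (fun x => f (shear b x)) = leb f.
Proof.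
move=> mf f0.
rewrite (leb_cons (measurableT_comp mf (measurable_shear b)) (fun=> f0 _)).
rewrite (leb_cons mf f0); apply: eq_integral => t _.
rewrite -(@leb_translate _ (t *: b)%R (fun y => f (vcons t y))); last 2 first.
- exact: (measurableT_comp mf (measurable_vconsr _)).
- by move=> y; exact: f0.
by apply: eq_leb => y; rewrite /= shear_vcons addrC.
Qed.

(* The reflection across the affine hyperplane [2 <v, w> = c]. *)
Definition reflection n (v : 'cV[R]_n) (c : R) (w : 'cV[R]_n) : 'cV[R]_n :=
  (w - ((2 * dot v w - c) / dot v v) *: v)%R.

Lemma measurable_reflection n (v : 'cV[R]_n) c : measurable_fun setT (reflection v c).
Proof.
apply: measurable_vadd => //; apply: measurable_vopp; apply: measurable_vscale => //.
apply: measurable_funM => //; apply: measurable_funB => //.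
by apply: measurable_funM => //; exact: measurable_dot.
Qed.

(* Conjugating by the shear that maps [v] to a multiple of the first basis
   vector turns the reflection into [t |-> k y - t] on the first coordinate. *)
Lemma leb_reflection n (v : 'cV[R]_n) (c : R) (f : 'cV[R]_n -> \bar R) :
  v != 0%R -> measurable_fun setT f -> (forall y, 0 <= f y) ->
  leb (fun w => f (reflection v c w)) = leb f.
Proof.
elim: n v f => [|n IH] v f; first by rewrite flatmx0 eqxx.
rewrite (vcons_surj v); set v0 := v ord0 ord0; set v' := (\col_i _)%R => vn0 mf f0.
have mr := measurable_reflection (vcons v0 v') c.
(* When the head of [v] vanishes, the reflection fixes the first coordinate and reflects the tail
   along [v'], so the induction hypothesis applies. *)
have [v00|v00] := eqVneq v0 0%R.
  have v'0 : v' != 0%R.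
    apply: contra_neq vn0 => ->; rewrite v00.
    by apply/matrixP => i j; rewrite !mxE; case: unliftP => [k|]//; rewrite mxE.
  rewrite (leb_cons (measurableT_comp mf mr) (fun=> f0 _)) (leb_cons mf f0).
  apply: eq_integral => t _.
  rewrite -(IH v' (fun y => f (vcons t y)) v'0); last 2 first.
  - exact: (measurableT_comp mf (measurable_vconsr _)).
  - by move=> y; exact: f0.
  apply: eq_leb => y /=.
  rewrite /reflection !dot_vcons v00 !mul0r !add0r -scaleNr vconsZ vconsD.
  by rewrite mulr0 addr0 scaleNr.
have vv0 : (v0 * v0 + dot v' v' != 0)%R.
  by rewrite gt_eqF// ltr_pwDl ?dot_ge0// -expr2 exprn_even_gt0.
(* With this [b] the shear maps [vcons v0 0] to [v]. *)
pose b := (v0^-1 *: v')%R.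
have ms := measurable_shear b.
rewrite -(leb_shear b (measurableT_comp mf mr) (fun=> f0 _)).
rewrite (leb_consC (measurableT_comp mf (measurableT_comp mr ms)) (fun=> f0 _)).
rewrite -(leb_shear b mf f0) (leb_consC (measurableT_comp mf ms) (fun=> f0 _)).
apply: eq_leb => y /=.
(* Along the sheared line, [2 <v, w> - c] equals [2 t <v, v> / v0 + 2 <v', y> - c]; subtracting
   [v0 / <v, v>] times this from [t] leaves [k - t]. As [k] depends on [y] alone, the inner integral
   undergoes an affine change of variable of slope -1. *)
pose k := ((c - 2 * dot v' y) * v0 / (v0 * v0 + dot v' v'))%R.
have N10 : (-1 != 0 :> R)%R by rewrite oppr_eq0 oner_eq0.
have mg : measurable_fun setT (fun t => f (shear b (vcons t y))).
  apply: (measurableT_comp mf); apply: (measurableT_comp ms).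
  exact: measurable_vcons.
rewrite [RHS](ge0_integral_affine k N10 mg (fun=> f0 _)).
rewrite normrN1 mul1e; apply: eq_integral => t _; congr f.
rewrite /affine !shear_vcons /reflection !dot_vcons dotDr !dotZr.
set s := (X in (X *: vcons v0 v')%R).
have sE : (k + -1 * t = t - s * v0)%R.
  by rewrite /k /s; field; rewrite vv0 v00.
rewrite sE -scaleNr vconsZ vconsD mulNr; congr vcons.
by rewrite scalerBl addrA scaleNr /b !(scalerA _ _ v') mulfK.
Qed.

End lebesgue_invariance.

Lemma measurable_boolr {R : realType} d (T : measurableType d) (b : T -> bool) :
  measurable_fun setT b -> measurable_fun setT (fun w => (b w)%:R : R).
Proof.
move=> mb.
have mr : measurable_fun setT (fun c : bool => c%:R : R) by move=> _ Y _.
exact: (measurableT_comp mr mb).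
Qed.

Lemma powR_le {R : realType} (x s p : R) : 0 <= x -> 0 <= s -> 0 < p ->
  (x `^ p <= s) = (x <= s `^ p^-1).
Proof.
move=> x0 s0 p0; have p1 : p * p^-1 = 1 by rewrite divff ?gt_eqF.
apply/idP/idP => h.
  rewrite -[leLHS](powRr1 x0) -p1 powRrM ge0_ler_powR ?nnegrE ?powR_ge0//.
  by rewrite invr_ge0 ltW.
rewrite -[leRHS](powRr1 s0) -p1 mulrC powRrM ge0_ler_powR ?nnegrE ?powR_ge0//.
exact: ltW.
Qed.

(** Exponentiated, this bounds [t^a e^(-t)] by a constant times [e^(-t/2)], whence the convergence
    of the Gamma integral. It is [ln x < x] at [x = t / (2 a)]. *)
Lemma ln_le_half {R : realType} (a t : R) : 0 < a -> 0 < t ->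
  a * ln t - t <= a * ln (2 * a) + - 2^-1 * t.
Proof.
move=> a0 t0.
have : a * ln (t / (2 * a)) <= a * (t / (2 * a)).
  by rewrite ler_pM2l//; apply/ltW/ln_sublinear; rewrite divr_gt0// mulr_gt0.
rewrite ln_div ?posrE ?mulr_gt0//.
have -> : a * (t / (2 * a)) = t / 2 by field; rewrite gt_eqF.
by rewrite mulrBr; lra.
Qed.

(** * The integral of [exp(-a |y|^p)], the Gamma function and the volume of balls *)

Section layer_cake.
Context {R : realType}.
Local Open Scope ereal_scope.
Notation GR := (measurableTypeR R).
Notation mu := (@lebesgue_measure R).

(** The extended value of the integral behind [Gamma], so that identities between integrals can be
    stated before convergence is known. *)
Definition egamma (x : R) : \bar R :=
  \int[mu]_(t in `]0%R, +oo[) (t `^ (x - 1) * expR (- t))%:E.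

Lemma integral_pos (F : R -> R) :
  \int[mu]_t (F t * (0 < t)%R%:R)%:E = \int[mu]_(t in `]0%R, +oo[) (F t)%:E.
Proof.
rewrite [RHS]integral_mkcond; apply: eq_integral => t _.
rewrite patchE mem_setE in_itv/= andbT.
by case: ifPn => _; rewrite ?mulr1 ?mulr0.
Qed.

(** The layers of the layer-cake formula, with [u = a |y|^p]. Conditions are indicator factors
    rather than domains so that Fubini applies on the whole line; the factor for [0 < t] matches the
    domain of the Gamma integral. *)
Lemma integral_exp_tail (u : R) : (0 <= u)%R ->
  \int[mu]_t (expR (- t) * (u <= t)%R%:R * (0 < t)%R%:R)%:E = (expR (- u))%:E.
Proof.
move=> u0.
pose F (v t : R) : R := (expR (- t) * (v <= t)%R%:R)%R.
have mF v : measurable_fun setT (F v : measurableTypeR R -> R).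
  apply: measurable_funM.
    by apply: measurableT_comp => //; exact: measurable_id.
  by apply: measurable_boolr; exact: measurable_fun_ler.
have mFE v : measurable_fun setT ((fun t => (F v t)%:E) : GR -> \bar R).
  exact: (measurableT_comp (@EFin_measurable R setT) (mF v)).
have F0 v t : (0 <= F v t)%R by rewrite mulr_ge0// expR_ge0.
rewrite integral_pos -/(F u).
(* Adding the negligible point 0 makes the domain contain every [t >= u], also for [u = 0], so that
   it can then be dropped. *)
have -> : \int[mu]_(t in `]0%R, +oo[) (F u t)%:E = \int[mu]_(t in `[0%R, +oo[) (F u t)%:E.
  apply: integral_itv_obnd_cbnd; apply: (@measurable_funTS _ _ GR).
  exact: (mFE u).
rewrite integral_mkcond.
have -> : (fun t => (F u t)%:E) \_ `[0%R, +oo[%classic = fun t => (F u t)%:E.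
  apply/funext => t; rewrite patchE mem_setE in_itv/= andbT.
  case: ifPn => //; rewrite -ltNge => t0.
  by rewrite /F leNgt (lt_le_trans t0 u0) mulr0.
have E0 : \int[mu]_t (F 0%R t)%:E = 1.
  rewrite -(@integral_exponential_pdf R 1 ltr01); apply: eq_integral => t _.
  rewrite /exponential_pdf patchE mem_setE in_itv/= andbT /F.
  by case: ifPn => _; rewrite ?mulr0// mulr1 mul1r mulN1r.
have FE0 v t : 0 <= (F v t)%:E by rewrite lee_fin.
rewrite (ge0_integral_affine u (oner_neq0 _) (mFE u) (FE0 u)) normr1 mul1e.
transitivity (\int[mu]_t ((expR (- u))%:E * (F 0%R t)%:E)).
  apply: eq_integral => t _.
  by rewrite /F /affine mul1r opprD expRD lerDl -EFinM mulrA.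
by rewrite ge0_integralZl ?E0 ?mule1// lee_fin expR_ge0.
Qed.

Lemma enormZ n (c : R) (y : 'cV[R]_n) : (0 <= c)%R -> enorm (c *: y) = (c * enorm y)%R.
Proof.
move=> c0; rewrite !enormE dotZl dotZr mulrA -expr2 sqrtrM ?sqr_ge0//.
by rewrite sqrtr_sqr ger0_norm.
Qed.

Lemma enorm_ge0 n (y : 'cV[R]_n) : (0 <= enorm y)%R.
Proof. exact: sqrtr_ge0. Qed.

Definition ball_volume n : \bar R :=
  leb (fun y : 'cV[R]_n => (enorm y <= 1)%R%:R%:E).

Lemma measurable_ball n (r : R) d (T : measurableType d) (f : T -> 'cV[R]_n) :
  measurable_fun setT f ->
  measurable_fun setT (fun w => ((enorm (f w) <= r)%R%:R%:E : \bar R)).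
Proof.
move=> mf; apply/measurable_EFinP/measurable_boolr.
by apply: measurable_fun_ler => //; exact: measurable_enorm.
Qed.

Lemma leb_ball n (r : R) : (0 < r)%R ->
  leb (fun y : 'cV[R]_n => (enorm y <= r)%R%:R%:E) = (r ^+ n)%:E * ball_volume n.
Proof.
move=> r0.
rewrite (@leb_scale R n r (fun y => (enorm y <= r)%R%:R%:E)).
- rewrite gtr0_norm//; congr (_ * _); apply: eq_leb => y.
  by rewrite (enormZ _ (ltW r0)) ger_pMr.
- by rewrite gt_eqF.
- exact: measurable_ball.
- by move=> y; rewrite lee_fin.
Qed.

(** After exchanging the integrals, level [t] contributes [e^(-t)] times the volume of the ball
    [a |y|^p <= t], which grows like [(t / a)^(n / p)]; integrating over [t] produces the Gamma
    factor. *)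
Lemma leb_exp n (a p : R) : (0 < a)%R -> (0 < p)%R ->
  leb (fun y : 'cV[R]_n => (expR (- (a * enorm y `^ p)))%:E) =
  ball_volume n * (a `^ (- (n%:R / p)))%:E * egamma (n%:R / p + 1).
Proof.
move=> a0 p0.
pose g (q : measurableTypeR R * 'cV[R]_n) : \bar R :=
  (expR (- q.1) * (a * enorm q.2 `^ p <= q.1)%R%:R * (0 < q.1)%R%:R)%:E.
have m1 : measurable_fun setT (fun q : measurableTypeR R * 'cV[R]_n => q.1 : R).
  exact: measurable_fst.
have mg : measurable_fun setT g.
  apply/measurable_EFinP; apply: measurable_funM; first apply: measurable_funM.
  - by apply: measurableT_comp => //; exact: measurable_funN.
  - apply: measurable_boolr; apply: measurable_fun_ler => //.
    apply: measurable_funM => //; apply: (measurableT_comp (measurable_powR p)).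
    exact: measurable_enorm.
  - by apply: measurable_boolr; exact: measurable_fun_ltr.
have g0 q : 0 <= g q by rewrite lee_fin !mulr_ge0// expR_ge0.
transitivity (leb (fun y => \int[mu]_t g (t, y))).
  apply: eq_leb => y; rewrite /g/= integral_exp_tail//.
  by rewrite mulr_ge0 ?powR_ge0// ltW.
rewrite -(leb_fubini mg g0).
transitivity (\int[mu]_t
    ((ball_volume n * (a `^ (- (n%:R / p)))%:E) *
     (t `^ (n%:R / p + 1 - 1) * expR (- t) * (0 < t)%R%:R)%:E)).
  apply: eq_integral => t _.
  have [t0|t0] := ltP 0%R t; last first.
    rewrite /g/= mulr0 mule0; rewrite /leb integral0_eq// => y _.
    by rewrite ltNge t0 mulr0 mul0e.
  (* The radius of the ball at level [t]. *)
  pose r := ((t / a) `^ p^-1)%R.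
  have r0 : (0 < r)%R by rewrite powR_gt0// divr_gt0.
  have rn : (r ^+ n = a `^ (- (n%:R / p)) * t `^ (n%:R / p))%R.
    rewrite -powR_mulrn ?(ltW r0)// /r -powRrM (mulrC p^-1%R).
    rewrite powRM ?invr_ge0 ?(ltW t0) ?(ltW a0)// -(powR_inv1 (ltW a0)).
    by rewrite -(powRrM a) mulN1r [LHS]mulrC.
  transitivity ((expR (- t))%:E * leb (fun y : 'cV[R]_n => (enorm y <= r)%R%:R%:E)).
    rewrite /leb -ge0_integralZl//; last 2 first.
    - by apply: measurable_lebi; exact: measurable_ball.
    - by move=> y _; rewrite mule_ge0 ?lee_fin// invr_ge0 phi_ge0.
    apply: eq_integral => y _; rewrite /g/= t0 mulr1 EFinM -muleA.
    congr (_ * (_%:R%:E * _)); congr nat_of_bool.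
    by rewrite mulrC -ler_pdivlMr// powR_le ?enorm_ge0// divr_ge0// ltW.
  rewrite leb_ball// rn addrK mulr1.
  rewrite muleA -EFinM muleC -muleA -EFinM; congr (_ * _%:E).
  by rewrite mulrCA (mulrC _ (expR _)) mulrCA.
have V0 : 0 <= ball_volume n by apply: leb_ge0 => y; rewrite lee_fin.
rewrite ge0_integralZl.
- by rewrite integral_pos.
- exact: measurableT.
- apply/measurable_EFinP; apply: measurable_funM; first apply: measurable_funM.
  + by apply: (measurableT_comp (measurable_powR _)); exact: measurable_id.
  + by apply: measurableT_comp => //; exact: measurable_id.
  + by apply: measurable_boolr; exact: measurable_fun_ltr.
- by move=> t _; rewrite lee_fin !mulr_ge0 ?powR_ge0 ?expR_ge0.
- by rewrite mule_ge0// lee_fin powR_ge0.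
Qed.

Lemma egamma_gt0 (x : R) : (1 < x)%R -> 0 < egamma x.
Proof.
move=> x1.
have mF : measurable_fun setT (fun t : GR => (t `^ (x - 1) * expR (- t))%:E).
  apply/measurable_EFinP/measurable_funM.
    by apply: (measurableT_comp (measurable_powR _)); exact: measurable_id.
  by apply: measurableT_comp => //; exact: measurable_id.
(* On [[1, 2]] the integrand is at least [e^(-2)], because [t^(x - 1) >= 1] there. *)
apply: (@lt_le_trans _ _ (\int[mu]_(t in `[1%R, 2%R]) (expR (-2))%:E)).
  rewrite integral_cst//= lebesgue_measure_itv/= lte_fin ltr1n -EFinB -EFinM lte_fin.
  by rewrite mulr_gt0 ?expR_gt0// subr_gt0 ltr1n.
apply: (@le_trans _ _ (\int[mu]_(t in `[1%R, 2%R]) (t `^ (x - 1) * expR (- t))%:E)).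
  apply: ge0_le_integral => //.
  - exact: (@measurable_funTS _ _ GR).
  - move=> t /=; rewrite in_itv/= => /andP[t1 t2].
    rewrite lee_fin -[leLHS]mul1r ler_pM ?expR_ge0 ?ler_expR ?lerN2//.
    by rewrite -[leLHS](powRr0 t) ler_powR// subr_ge0 ltW.
apply: ge0_subset_integral => //.
- exact: (@measurable_funTS _ _ GR).
- by move=> t _; rewrite lee_fin mulr_ge0 ?powR_ge0 ?expR_ge0.
- by apply: subset_itv; rewrite bnd_simp.
Qed.

Lemma egamma_lty (x : R) : (1 < x)%R -> egamma x < +oo.
Proof.
move=> x1; pose a := (x - 1)%R; have a0 : (0 < a)%R by rewrite subr_gt0.
(* The first factor comes from [ln_le_half]; the 2 cancels the normalization of the exponential
   density of rate 1/2, which serves as majorant. *)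
pose C := (expR (a * ln (2 * a)) * 2)%R.
have C0 : (0 <= C)%R by rewrite mulr_ge0 ?expR_ge0.
have mF : measurable_fun setT (fun t : GR => (t `^ a * expR (- t))%:E).
  apply/measurable_EFinP/measurable_funM.
    by apply: (measurableT_comp (measurable_powR _)); exact: measurable_id.
  by apply: measurableT_comp => //; exact: measurable_id.
have mE : measurable_fun setT (EFin \o exponential_pdf (2^-1 : R)).
  by apply/measurable_EFinP; exact: measurable_exponential_pdf.
have E0 t : 0 <= (exponential_pdf (2^-1 : R) t)%:E.
  by rewrite lee_fin exponential_pdf_ge0.
apply: (@le_lt_trans _ _ (\int[mu]_(t in `]0%R, +oo[) (C%:E * (exponential_pdf (2^-1 : R) t)%:E))).
  apply: ge0_le_integral => //.
  - by move=> t _; rewrite lee_fin mulr_ge0 ?powR_ge0 ?expR_ge0.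
  - exact: (@measurable_funTS _ _ GR).
  - apply: (@measurable_funTS _ _ GR); exact: emeasurable_funM.
  - move=> t /=; rewrite in_itv/= andbT => t0.
    rewrite exponential_pdfE ?(ltW t0)// -EFinM lee_fin.
    have -> : (C * (2^-1 * expR (- 2^-1 * t)) = expR (a * ln (2 * a) + - 2^-1 * t))%R.
      by rewrite expRD /C; field.
    rewrite /powR gt_eqF// -expRD ler_expR.
    by rewrite ln_le_half.
apply: (@le_lt_trans _ _ (\int[mu]_t (C%:E * (exponential_pdf (2^-1 : R) t)%:E))).
  apply: ge0_subset_integral => //.
  - exact: emeasurable_funM.
  - by move=> t _; rewrite mule_ge0.
rewrite ge0_integralZl//.
by rewrite integral_exponential_pdf// mule1 ltry.
Qed.

Lemma egammaE (x : R) : (1 < x)%R -> egamma x = (Gamma x)%:E.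
Proof.
move=> x1; rewrite /Gamma /Rintegral fineK// ge0_fin_numE ?egamma_lty//.
exact/ltW/egamma_gt0.
Qed.

Lemma Gamma_gt0 (x : R) : (1 < x)%R -> (0 < Gamma x)%R.
Proof. by move=> x1; rewrite -lte_fin -egammaE// egamma_gt0. Qed.

Lemma leb_phi n : leb (fun y : 'cV[R]_n => (phi y)%:E) = 1.
Proof.
transitivity (\int[gam n]_y (cst 1 : 'cV[R]_n -> \bar R) y).
  by rewrite integral_gam; apply: eq_leb => y; rewrite mul1e.
by rewrite integral_cst// mul1e; exact: probability_setT.
Qed.

Lemma ball_volumeE n : (0 < n)%N ->
  ball_volume n = (Num.sqrt pi ^+ n / Gamma (n%:R / 2 + 1))%:E.
Proof.
move=> n0.
have g1 : (1 < n%:R / 2 + 1 :> R)%R by rewrite ltrDr divr_gt0// ltr0n.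
have G0 := Gamma_gt0 g1.
(* For [p = 2] and [a = 1/2] the integrand is [phi] up to its normalization, so the integral is
   known and [leb_exp] can be solved for the volume. *)
have : leb (fun y : 'cV[R]_n => (expR (- (2^-1 * enorm y `^ 2)))%:E) =
    (Num.sqrt (2 * pi) ^+ n)%:E.
  rewrite -[RHS]mule1 -(leb_phi n) /leb -ge0_integralZl//; last 2 first.
  - apply: (measurable_lebi (f := fun y => (phi y)%:E)).
    by apply/measurable_EFinP/measurable_phi.
  - by move=> y _; rewrite mule_ge0 ?lee_fin ?invr_ge0 ?phi_ge0.
  apply: eq_integral => y _; rewrite muleA -(EFinM (_ ^+ _)).
  rewrite [X in _ = X%:E * _](_ : _ = expR (- (2^-1 * enorm y `^ 2)))%R//.
  rewrite /phi mulrA divff ?mul1r; last by rewrite expf_neq0// gt_eqF// sqrt2pi_gt0.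
  by rewrite powR_mulrn ?enorm_ge0// enormE sqr_sqrtr ?dot_ge0// mulrC.
rewrite leb_exp// egammaE//.
have : 0 <= ball_volume n by apply: leb_ge0 => y; rewrite lee_fin.
have p2 : (0 < 2^-1 `^ (- (n%:R / 2)) :> R)%R by rewrite powR_gt0.
(* An infinite volume would make this Gaussian integral infinite. *)
case: (ball_volume n) => [v|_|//]; last first.
  by rewrite gt0_mulye ?lte_fin// gt0_mulye ?lte_fin.
rewrite -!EFinM => _ [] vE; congr _%:E.
apply: (mulIf (x := 2^-1 `^ (- (n%:R / 2)) * Gamma (n%:R / 2 + 1))%R).
  by rewrite mulf_neq0 ?gt_eqF.
rewrite mulrA vE mulrCA divfK ?gt_eqF// sqrtrM// exprMn; congr (_ * _)%R.
rewrite -powR_mulrn// -powR12_sqrt// -powRrM mulrC.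
by rewrite -powR_inv1// -powRrM mulN1r opprK.
Qed.

End layer_cake.

(** * Identification of the noise law with [gam] *)

Section standard_gaussian_law.
Context {R : realType}.
Local Open Scope ereal_scope.
Notation GR := (measurableTypeR R).
Notation mu := (@lebesgue_measure R).

Definition box n (A : 'I_n -> set R) : set 'cV[R]_n := [set z | forall i, A i (z i ord0)].

Definition boxes n : set (set 'cV[R]_n) :=
  [set B | exists2 A, (forall i, measurable (A i)) & B = box A].

Lemma measurable_box n (A : 'I_n -> set R) : (forall i, measurable (A i)) ->
  measurable (box A).
Proof.
move=> mA; rewrite (_ : box A = \bigcap_(i in [set: 'I_n])
    ((fun z : 'cV[R]_n => z i ord0) @^-1` A i)); last first.
  by apply/seteqP; split => [z Az i _|z Az i]; [exact: Az|exact: (Az i I)].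
rewrite bigcap_fset_set//; last exact: finite_finset.
apply: bigsetI_measurable => i _.
by have := @measurable_entry _ R n 1 i ord0 measurableT (A i) (mA i); rewrite setTI.
Qed.

Lemma sigma_algebra_boxes n : @measurable _ 'cV[R]_n = <<s @boxes n >>.
Proof.
apply/seteqP; split.
  apply: smallest_sub; first exact: smallest_sigma_algebra.
  move=> _ [i [j [B mB ->]]]; rewrite (ord1 j); apply: sub_sigma_algebra.
  exists (fun k => if k == i then B else setT).
    by move=> k; case: ifPn.
  apply/seteqP; split => z /= Bz.
    by move=> k; case: eqP => // ->.
  by have := Bz i; rewrite eqxx.
apply: smallest_sub; first exact: sigma_algebra_measurable.
by move=> _ [A mA ->]; exact: measurable_box.
Qed.

Lemma gam_box n (A : 'I_n -> set R) : (forall i, measurable (A i)) ->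
  gam n (box A) = \prod_(i < n) normal_prob 0 1 (A i).
Proof.
elim: n A => [|n IH] A mA.
  rewrite big_ord0 /= diracE mem_set// => -[]//.
rewrite big_ord_recl -(IH (fun i => A (lift ord0 i)))//.
rewrite /= /distribution /pushforward.
rewrite (_ : _ @^-1` _ = (A ord0 : set GR) `*` box (fun i => A (lift ord0 i))); last first.
  apply/seteqP; split => -[t y] /=.
    move=> Az; split; first by have := Az ord0; rewrite vcons0.
    by move=> i; have := Az (lift ord0 i); rewrite vconsS.
  move=> [At Ay] i.
  by case: (unliftP ord0 i) => [k ->|->]; rewrite ?vconsS ?vcons0//; exact: Ay.
rewrite product_measure1E//; first exact: (mA ord0).
exact: (measurable_box (fun i => mA _)).
Qed.

(** The hypothesis fixes the law on boxes only; these are stable under intersection and generate the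
    sigma-algebra, so they determine it. *)
Lemma standard_gaussian_gam n d (T : measurableType d) (P : probability T R)
    (Z : {mfun T >-> 'cV[R]_n}) : standard_gaussian P Z ->
  forall A, measurable A -> distribution P Z A = gam n A.
Proof.
move=> gZ A mA.
apply: (@measure_unique _ R _ (@boxes n) (fun=> setT) _ _ _ _
  (distribution P Z) (gam n)) => //.
- exact: sigma_algebra_boxes.
- move=> _ _ [B mB ->] [C mC ->]; exists (fun i => B i `&` C i).
    by move=> i; exact: measurableI.
  apply/seteqP; split => z /=; first by move=> [Bz Cz] i; split.
  by move=> BCz; split => i; have [] := BCz i.
- by move=> _; exists (fun=> setT) => //; apply/seteqP; split.
- by apply/seteqP; split => // z _; exists 0%N.
- by move=> _ [B mB ->]; exact: etrans (gZ B mB) (esym (gam_box mB)).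
- by move=> _; rewrite (le_lt_trans (probability_le1 _ _)) ?ltry.
Qed.

Lemma ge0_integral_gaussian n d (T : measurableType d) (P : probability T R)
    (Z : {mfun T >-> 'cV[R]_n}) (f : 'cV[R]_n -> \bar R) : standard_gaussian P Z ->
  measurable_fun setT f -> (forall y, 0 <= f y) ->
  \int[P]_w f (Z w) = \int[gam n]_y f y.
Proof.
move=> gZ mf f0; rewrite -(@ge0_integral_distribution _ _ _ _ _ P Z f mf f0).
by apply: eq_measure_integral => A mA _; exact: standard_gaussian_gam.
Qed.

Lemma ge0_integral_gam_shift n (x : 'cV[R]_n) (f : 'cV[R]_n -> \bar R) :
  measurable_fun setT f -> (forall y, 0 <= f y) ->
  \int[gam n]_z f (x + z)%R = leb (fun y => f y * (phi (y - x)%R)%:E).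
Proof.
move=> mf f0; rewrite integral_gam.
rewrite -(@leb_translate _ _ x (fun y => f y * (phi (y - x)%R)%:E)).
- by apply: eq_leb => y; rewrite addrAC subrr add0r.
- apply: emeasurable_funM => //; apply/measurable_EFinP/measurable_phi.
  exact: measurable_vadd.
- by move=> y; rewrite mule_ge0// lee_fin phi_ge0.
Qed.

Lemma ge0_lebD n (f g : 'cV[R]_n -> \bar R) :
  measurable_fun setT f -> measurable_fun setT g ->
  (forall y, 0 <= f y) -> (forall y, 0 <= g y) ->
  leb (fun y => f y + g y) = leb f + leb g.
Proof.
move=> mf mg f0 g0; rewrite /leb -ge0_integralD//; first last.
- exact: measurable_lebi.
- by move=> y _; rewrite mule_ge0// lee_fin invr_ge0 phi_ge0.
- exact: measurable_lebi.
- by move=> y _; rewrite mule_ge0// lee_fin invr_ge0 phi_ge0.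
by apply: eq_integral => y _; rewrite ge0_muleDl.
Qed.

Lemma ge0_leb_le n (f g : 'cV[R]_n -> \bar R) :
  measurable_fun setT f -> measurable_fun setT g ->
  (forall y, 0 <= f y) -> (forall y, f y <= g y) -> leb f <= leb g.
Proof.
move=> mf mg f0 fg; apply: ge0_le_integral => //.
- by move=> y _; rewrite mule_ge0// lee_fin invr_ge0 phi_ge0.
- exact: measurable_lebi.
- exact: measurable_lebi.
- by move=> y _; rewrite lee_wpmul2r// lee_fin invr_ge0 phi_ge0.
Qed.

End standard_gaussian_law.

(** * The reflection exchanging two centers *)

Section reflection_principle.
Context {R : realType} {n : nat}.
Implicit Types x v w : 'cV[R]_n.

(** Opposite [v] and [c] describe the same hyperplane; this is the effect of exchanging [x] and [x']
    below. *)
Lemma reflectionN v c w : reflection (- v) (- c) w = reflection v c w.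
Proof.
rewrite /reflection !(dotNl, dotNr) !opprK; congr (_ - _).
rewrite (_ : _ + c = - (2 * dot v w - c)); last by ring.
by rewrite mulNr scaleNr scalerN opprK.
Qed.

(** When [c >= 0], the sign of [2 <v, w> - c] thus decides whether the reflection shortens or
    lengthens [w]. *)
Lemma dot_reflection v c w : dot v v != 0 ->
  dot (reflection v c w) (reflection v c w) =
  dot w w - (2 * dot v w - c) / dot v v * c.
Proof.
move=> v0; rewrite /reflection.
rewrite !(dotDl, dotDr, dotNl, dotNr, dotZl, dotZr) (dotC w v).
by field.
Qed.

Variables x x' : 'cV[R]_n.
Hypothesis xx' : x' != x.
(** With this [v] and the next [c], the hyperplane [2 <v, w> = c] is the perpendicular bisector of
    [x] and [x'], and [s w >= 0] on the side of [x']. *)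
Let v := x' - x.
Let c := dot x' x' - dot x x.
Let s w := (2 * dot v w - c) / dot v v.

Let vv_gt0 : 0 < dot v v.
Proof.
rewrite lt_neqAle dot_ge0 andbT eq_sym; apply: contra_neq xx' => /dot_eq0 /eqP.
by rewrite subr_eq0 => /eqP.
Qed.

Let sE w : s w * dot v v = 2 * dot v w - c.
Proof. by rewrite /s divfK// gt_eqF. Qed.

(** The reflection is an isometry that exchanges [x] and [x'], so [r w] is as far from [x] as [w] is
    from [x']. *)
Lemma phi_reflection w : phi (reflection v c w - x) = phi (w - x').
Proof.
congr (_ * expR (- (_ / 2))).
rewrite /reflection -/(s w); have := sE w; set t := s w.
rewrite /c /v !(dotDl, dotDr, dotNl, dotNr, dotZl, dotZr).
rewrite (dotC w x') (dotC w x) (dotC x x').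
move: (dot x x) (dot x' x') (dot x' x) (dot x' w) (dot x w) (dot w w) => a b e d f g.
move=> /eqP; rewrite -subr_eq0 => /eqP h; apply/eqP; rewrite -subr_eq0; apply/eqP.
(* The two squared distances differ by [t - 1] times the relation [h] that defines [t]. *)
by apply: (etrans _ (mulr0 (t - 1))); rewrite -[X in _ = _ * X]h; ring.
Qed.

Lemma phi_le_shift w : (phi (w - x) <= phi (w - x')) = (0 <= s w).
Proof.
rewrite /phi ler_pM2l ?invr_gt0 ?exprn_gt0 ?sqrt2pi_gt0//.
rewrite ler_expR lerN2 ler_pM2r// -subr_ge0.
rewrite -[RHS](pmulr_lge0 _ vv_gt0) sE /c /v; congr (0 <= _).
rewrite !(dotDl, dotDr, dotNl, dotNr) (dotC w x') (dotC w x); ring.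
Qed.

End reflection_principle.

(** * Monotonicity of [E|x + Z|^p] in the norm of [x] *)

Section gaussian_moments.
Context {R : realType}.
Local Open Scope ereal_scope.

Lemma lee_double (a b : \bar R) : a + a <= b + b -> a <= b.
Proof.
have two0 : (0 : \bar R) < 2%:E by rewrite lte_fin.
by rewrite -!mule2n -!mule_natl lee_pmul2l.
Qed.

Lemma le_eq2 (a b c d : \bar R) : a = c -> b = d -> a <= b -> c <= d.
Proof. by move=> -> ->. Qed.

(* With [F w = |w|^p], the reflection [r] exchanging [x] and [x'] makes twice
   each moment the Lebesgue integral of one side of the pointwise inequality
   [F w phi(w-x) + F(r w) phi(w-x') <= F w phi(w-x') + F(r w) phi(w-x)]. *)
Lemma le_gaussian_moment n (x x' : 'cV[R]_n) (p : R) : (0 < p)%R ->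
  (dot x x <= dot x' x')%R ->
  \int[gam n]_z (enorm (x + z) `^ p)%:E <= \int[gam n]_z (enorm (x' + z) `^ p)%:E.
Proof.
move=> p0 le_xx'; have [->//|xx'] := eqVneq x' x.
pose F (y : 'cV[R]_n) : \bar R := (enorm y `^ p)%:E.
have mF : measurable_fun setT F.
  apply/measurable_EFinP; apply: (measurableT_comp (measurable_powR p)).
  exact: measurable_enorm.
have F0 y : 0 <= F y by rewrite lee_fin powR_ge0.
rewrite (ge0_integral_gam_shift x mF F0) (ge0_integral_gam_shift x' mF F0).
pose r := reflection (x' - x)%R (dot x' x' - dot x x)%R.
have mr : measurable_fun setT r by exact: measurable_reflection.
pose Fr y := F (r y).
have mFr : measurable_fun setT Fr by exact: measurableT_comp.
have mphi z : measurable_fun setT (fun y : 'cV[R]_n => (phi (y - z)%R)%:E).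
  by apply/measurable_EFinP/measurable_phi; exact: measurable_vadd.
have mM (f : 'cV[R]_n -> \bar R) z : measurable_fun setT f ->
    measurable_fun setT (fun y => f y * (phi (y - z)%R)%:E).
  by move=> mf; exact: emeasurable_funM.
have M0 (f : 'cV[R]_n -> \bar R) z : (forall y, 0 <= f y) ->
    forall y, 0 <= f y * (phi (y - z)%R)%:E.
  by move=> f0 y; rewrite mule_ge0// lee_fin phi_ge0.
have v0 : (x' - x != 0)%R by rewrite subr_eq0.
have vv0 : (0 < dot (x' - x) (x' - x))%R.
  by rewrite lt_neqAle dot_ge0 andbT eq_sym; apply: contra_neq v0; exact: dot_eq0.
(* Reflecting the variable trades [F] for [F] after [r] and moves the center from [z] to [z']. *)
have rE z z' : (forall w, phi (r w - z) = phi (w - z'))%R ->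
    leb (fun y => F y * (phi (y - z)%R)%:E) =
    leb (fun y => Fr y * (phi (y - z')%R)%:E).
  move=> zz'.
  rewrite -(leb_reflection (dot x' x' - dot x x)%R v0 (mM _ z mF) (M0 _ z F0)).
  by apply: eq_leb => w; rewrite /Fr -zz'.
have phix w : phi (r w - x)%R = phi (w - x')%R by exact: phi_reflection.
have phix' w : phi (r w - x')%R = phi (w - x)%R.
  by rewrite /r -reflectionN !opprB phi_reflection// eq_sym.
have Fr0 y : 0 <= Fr y by exact: F0.
apply: lee_double.
rewrite [X in _ + X <= _](rE _ _ phix) [X in _ <= _ + X](rE _ _ phix').
have E1 := ge0_lebD (mM _ x mF) (mM _ x' mFr) (M0 _ x F0) (M0 _ x' Fr0).
have E2 := ge0_lebD (mM _ x' mF) (mM _ x mFr) (M0 _ x' F0) (M0 _ x Fr0).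
apply: (le_eq2 E1 E2); apply: ge0_leb_le.
- by apply: emeasurable_funD; exact: mM.
- by apply: emeasurable_funD; exact: mM.
- by move=> y; rewrite adde_ge0//; [exact: M0|exact: M0].
move=> w; rewrite /Fr /F /= -!EFinM -!EFinD lee_fin -subr_ge0.
set a := (enorm w `^ p)%R; set b := (enorm (r w) `^ p)%R.
set f := phi (w - x)%R; set g := phi (w - x')%R.
rewrite (_ : (_ - _)%R = ((a - b) * (g - f))%R); last by ring.
(* The two factors have the same sign on each side of the bisector. On the side of [x'], [c >= 0]
   gives [|r w| <= |w|], and the density centered at [x'] is the larger one; on the other side both
   comparisons are reversed. *)
have [s0|s0] := leP 0%R ((2 * dot (x' - x) w - (dot x' x' - dot x x)) / dot (x' - x) (x' - x))%R.
  apply: mulr_ge0; rewrite subr_ge0; last by rewrite phi_le_shift.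
  rewrite ge0_ler_powR ?nnegrE ?enorm_ge0 ?(ltW p0)// !enormE ler_sqrt ?dot_ge0//.
  by rewrite dot_reflection ?gt_eqF// gerBl mulr_ge0// subr_ge0.
apply: mulr_le0; rewrite subr_le0.
  rewrite ge0_ler_powR ?nnegrE ?enorm_ge0 ?(ltW p0)// !enormE ler_sqrt ?dot_ge0//.
  by rewrite dot_reflection ?gt_eqF// lerBrDl gerDr nmulr_rle0// subr_ge0.
by apply/ltW; rewrite ltNge phi_le_shift// -ltNge.
Qed.

End gaussian_moments.

Lemma bernoulli_ineq {R : realType} n (d : R) : 0 <= d -> 1 + n%:R * d <= (1 + d) ^+ n.
Proof.
move=> d0; elim: n => [|n IH]; first by rewrite mul0r addr0 expr0.
have d1 : 0 <= 1 + d by rewrite addr_ge0.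
rewrite exprS (le_trans _ (ler_wpM2l d1 IH))// -natr1.
have := mulr_ge0 (ler0n R n) (mulr_ge0 d0 d0).
by lra.
Qed.

(** * The second moment of the Gaussian law *)

Section second_moment.
Context {R : realType}.
Local Open Scope ereal_scope.

Lemma phiZ n (c : R) (y : 'cV[R]_n) :
  phi (c *: y)%R = (expR (- ((c ^+ 2 - 1) / 2 * dot y y)) * phi y)%R.
Proof.
rewrite /phi dotZl dotZr [RHS]mulrCA -expRD; congr (_ * expR _)%R.
by field.
Qed.

(** The integrand times [phi y] is [phi (c *: y)], so the value is a scaling factor of Lebesgue
    measure. *)
Lemma integral_gam_exp n (c : R) : (0 < c)%R ->
  \int[gam n]_y (expR (- ((c ^+ 2 - 1) / 2 * dot y y)))%:E = (c ^- n)%:E.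
Proof.
move=> c0; rewrite integral_gam.
pose L := leb (fun y : 'cV[R]_n => (phi (c *: y)%R)%:E).
have -> : leb (fun y : 'cV[R]_n =>
    (expR (- ((c ^+ 2 - 1) / 2 * dot y y)))%:E * (phi y)%:E) = L.
  by apply: eq_leb => y; rewrite phiZ.
have : 1 = (c ^+ n)%:E * L.
  rewrite -(leb_phi n) (@leb_scale R n c).
  - by rewrite gtr0_norm.
  - by rewrite gt_eqF.
  - exact/measurable_EFinP/measurable_phi.
  - by move=> y; rewrite lee_fin phi_ge0.
move=> /(congr1 (fun x => (c ^- n)%:E * x)).
by rewrite mule1 muleA -EFinM mulVf ?mul1e// expf_neq0// gt_eqF.
Qed.

Let measurable_dotE n :
  measurable_fun setT (fun y : 'cV[R]_n => (dot y y)%:E).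
Proof. exact/measurable_EFinP/measurable_dot. Qed.

Let measurable_exp_dot n (b : R) :
  measurable_fun setT (fun y : 'cV[R]_n => (expR (- (b * dot y y)))%:E).
Proof.
apply/measurable_EFinP; apply: measurableT_comp => //; apply: measurableT_comp => //.
by apply: measurable_funM => //; exact: measurable_dot.
Qed.

Lemma gaussian_moment2_lty n :
  \int[gam n]_(y in [set: 'cV[R]_n]) (dot y y)%:E < +oo.
Proof.
(* For [c^2 = 1/2] the exponential is [exp(|y|^2 / 4)], still integrable, and 4 times it dominates
   [|y|^2] by [e^x >= 1 + x]. *)
have c0 : (0 < Num.sqrt 2^-1 :> R)%R by rewrite sqrtr_gt0.
apply: (@le_lt_trans _ _ (\int[gam n]_y
    (4%:E * (expR (- ((Num.sqrt 2^-1 ^+ 2 - 1) / 2 * dot y y)))%:E))).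
  apply: ge0_le_integral => //.
  - by move=> y _; rewrite lee_fin dot_ge0.
  - exact: measurable_dotE.
  - by apply: emeasurable_funM => //; exact: measurable_exp_dot.
  - move=> y _; rewrite -EFinM lee_fin sqr_sqrtr//.
    have := expR_ge1Dx (dot y y / 4)%R.
    have -> : (- ((2^-1 - 1) / 2 * dot y y) = dot y y / 4)%R by field.
    lra.
rewrite ge0_integralZl//; last exact: measurable_exp_dot.
by rewrite integral_gam_exp// -EFinM ltry.
Qed.

(* [e^(-s) >= 1 - s] and [E exp(-(c^2-1)/2 |Z|^2) = c^-n], with [c = 1 + e]. *)
Lemma gaussian_moment2_ge n :
  n%:R%:E <= \int[gam n]_(y in [set: 'cV[R]_n]) (dot y y)%:E.
Proof.
have := gaussian_moment2_lty n.
have : 0 <= \int[gam n]_(y in [set: 'cV[R]_n]) (dot y y)%:E.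
  by apply: integral_ge0 => y _; rewrite lee_fin dot_ge0.
case E : (\int[gam n]_(y in [set: 'cV[R]_n]) (dot y y)%:E) => [S| |]// S0 _; rewrite lee_fin in S0.
have H (e : R) : (0 < e)%R -> (1 <= (1 + e) ^- n + ((1 + e) ^+ 2 - 1) / 2 * S)%R.
  move=> e0; have c0 : (0 < 1 + e)%R by rewrite addr_gt0.
  have t0 : (0 <= ((1 + e) ^+ 2 - 1) / 2)%R.
    by rewrite divr_ge0// subr_ge0 exprn_ege1// lerDl ltW.
  rewrite -lee_fin EFinD -(integral_gam_exp n c0) EFinM -E.
  rewrite -ge0_integralZl//; last 2 first.
  - exact: measurable_dotE.
  - by move=> y _; rewrite lee_fin dot_ge0.
  rewrite -ge0_integralD//; last 3 first.
  - exact: measurable_exp_dot.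
  - by move=> y _; rewrite -EFinM lee_fin mulr_ge0 ?dot_ge0.
  - by apply: emeasurable_funM => //; exact: measurable_dotE.
  apply: (@le_trans _ _ (\int[gam n]_y (cst 1 : 'cV[R]_n -> \bar R) y)).
    rewrite integral_cst// mul1e le_eqVlt; apply/orP; left; apply/eqP/esym.
    exact: probability_setT.
  apply: ge0_le_integral => //.
  - apply: emeasurable_funD; first exact: measurable_exp_dot.
    by apply: emeasurable_funM => //; exact: measurable_dotE.
  - move=> y _; rewrite -EFinM -EFinD lee_fin.
    by have := expR_ge1Dx (- (((1 + e) ^+ 2 - 1) / 2 * dot y y))%R; lra.
rewrite lee_fin; apply/ler_addgt0Pr => e e0.
pose N : R := n%:R; have N0 : (0 <= N)%R by rewrite /N.
(* The excess over [S] will be at most [d ((2 N + 1) S + 1)]. The minimum with 1 gives [d^2 <= d],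
   and the added 1 keeps the denominator positive. *)
pose d := Num.min 1%R (e / ((2 * N + 1) * S + 1))%R.
have den0 : (0 < (2 * N + 1) * S + 1)%R.
  by rewrite ltr_wpDl// mulr_ge0// addr_ge0// mulr_ge0.
have d0 : (0 < d)%R by rewrite lt_min ltr01/= divr_gt0.
have d1 : (d <= 1)%R by rewrite ge_min lexx.
have de : (d * ((2 * N + 1) * S + 1) <= e)%R.
  by rewrite -ler_pdivlMr// ge_min lexx orbT.
have hd := H d d0.
have c0 : (0 < 1 + N * d)%R by rewrite ltr_pwDl// mulr_ge0// ltW.
(* Replacing the power by a linear expression allows the denominator to be cleared and one factor
   [d] to be divided out. *)
have bern : ((1 + d) ^- n <= (1 + N * d)^-1)%R.
  rewrite lef_pV2 ?posrE ?exprn_gt0 ?c0// ?addr_gt0//.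
  exact: (bernoulli_ineq n (ltW d0)).
have h1 : (1 <= (1 + N * d)^-1 + ((1 + d) ^+ 2 - 1) / 2 * S)%R.
  by apply: (le_trans hd); rewrite lerD2r.
have h2 : (1 + N * d <= 1 + ((1 + d) ^+ 2 - 1) / 2 * S * (1 + N * d))%R.
  by move: h1; rewrite -(ler_pM2r c0) mulrDl mulVf ?gt_eqF// mul1r.
have h3 : (N <= (1 + d / 2) * S * (1 + N * d))%R.
  rewrite -(ler_pM2l d0); move: h2; rewrite lerD2l.
  have -> : (((1 + d) ^+ 2 - 1) / 2 * S * (1 + N * d) =
     d * ((1 + d / 2) * S * (1 + N * d)))%R by field.
  by rewrite mulrC.
apply: (le_trans h3); apply: (@le_trans _ _ (S + d * ((2 * N + 1) * S + 1))%R); last first.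
  by rewrite lerD2l.
have SNd : (0 <= S * N * d)%R by rewrite !mulr_ge0// ltW.
have Sd : (0 <= S * d)%R by rewrite mulr_ge0// ltW.
have : (S * N * d * d <= S * N * d)%R by rewrite ler_piMr.
lra.
Qed.

End second_moment.

(** * Joint and output densities of the channel *)

Section channel_densities.
Context {R : realType} {d : measure_display} {T : measurableType d}.
Context {nt nr : nat} (H : 'M[R]_(nr, nt)) (P : probability T R).
Context (U : {mfun T >-> 'cV[R]_nt}) (Z : {mfun T >-> 'cV[R]_nr}).
Hypothesis gZ : standard_gaussian P Z.
Hypothesis indUZ : independent_rv P U Z.
Local Open Scope ereal_scope.

Notation PU := (distribution P U).
Notation Y := (channel_output H U Z).
Notation PY := (distribution P Y).
Notation V := ('cV[R]_nt * 'cV[R]_nr)%type.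

Lemma ge0_integral_UZ (g : V -> \bar R) :
  measurable_fun setT g -> (forall q, 0 <= g q) ->
  \int[P]_w g (U w, Z w) = \int[PU \x gam nr]_q g q.
Proof.
move=> mg g0.
transitivity (\int[distribution P (rv_pair U Z)]_q g q).
  by rewrite ge0_integral_distribution.
apply: eq_measure_integral => A mA _; apply/esym.
apply: product_measure_unique => // B C mB mC.
transitivity (PU B * distribution P Z C); first exact: indUZ.
by congr (_ * _); exact: standard_gaussian_gam.
Qed.

Definition cond_density (q : V) : R := phi (q.2 - H *m q.1)%R.

Lemma measurable_cond_density : measurable_fun setT cond_density.
Proof.
apply: measurable_phi; apply: measurable_vadd; first exact: measurable_snd.
by apply: measurable_vopp; apply: measurable_vmul; exact: measurable_fst.
Qed.

Let mcond : measurable_fun setT (fun q => (cond_density q)%:E).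
Proof. by apply/measurable_EFinP; exact: measurable_cond_density. Qed.

Let mphiV : measurable_fun setT (fun q : V => ((phi q.2)^-1)%:E).
Proof.
apply/measurable_EFinP.
exact: (measurable_phiV (f := fun q : V => q.2) measurable_snd).
Qed.

(** For a fixed input the output is a shifted Gaussian. The factor [1 / phi] turns the reference law
    [gam] of the second component into Lebesgue measure. *)
Lemma ge0_integral_UY (g : V -> \bar R) :
  measurable_fun setT g -> (forall q, 0 <= g q) ->
  \int[P]_w g (U w, Y w) =
  \int[PU \x gam nr]_q (g q * (cond_density q)%:E * ((phi q.2)^-1)%:E).
Proof.
move=> mg g0.
pose g' (q : V) := g (q.1, H *m q.1 + q.2)%R.
have mg' : measurable_fun setT g'.
  apply: measurableT_comp => //; apply: measurable_fun_pair; first exact: measurable_fst.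
  apply: measurable_vadd; last exact: measurable_snd.
  by apply: measurable_vmul; exact: measurable_fst.
have g'0 q : 0 <= g' q by exact: g0.
pose h q := g q * (cond_density q)%:E * ((phi q.2)^-1)%:E.
have mh : measurable_fun setT h.
  by apply: emeasurable_funM => //; exact: emeasurable_funM.
have h0 q : 0 <= h q by rewrite !mule_ge0// lee_fin ?invr_ge0 phi_ge0.
transitivity (\int[P]_w g' (U w, Z w)); first by [].
rewrite (ge0_integral_UZ mg' g'0).
rewrite (fubini_tonelli1 (m1 := PU) (m2 := gam nr) g' mg' g'0).
rewrite (fubini_tonelli1 (m1 := PU) (m2 := gam nr) h mh h0).
apply: eq_integral => u _.
exact: (ge0_integral_gam_shift (H *m u)%R (measurableT_comp mg (measurable_pair1 u)) (fun=> g0 _)).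
Qed.

Definition out_density (y : 'cV[R]_nr) : R :=
  fine (\int[PU]_u (cond_density (u, y))%:E).

Let mcond_u (y : 'cV[R]_nr) : measurable_fun setT (fun u => (cond_density (u, y))%:E).
Proof. exact: (measurableT_comp mcond (measurable_pair2 y)). Qed.

Let cond_density_ge0 q : 0 <= (cond_density q)%:E.
Proof. by rewrite lee_fin phi_ge0. Qed.

(** The conditional density is bounded by the peak value of [phi], so its average over the inputs is
    finite and [fine] loses nothing. *)
Lemma out_densityE y : (out_density y)%:E = \int[PU]_u (cond_density (u, y))%:E.
Proof.
rewrite /out_density fineK// ge0_fin_numE; last exact: integral_ge0.
pose C : R := ((Num.sqrt (2 * pi)) ^- nr)%R.
apply: (@le_lt_trans _ _ (\int[PU]_u (cst C%:E : 'cV[R]_nt -> \bar R) u)).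
  apply: ge0_le_integral => // u _; rewrite lee_fin /cond_density /phi -/C.
  rewrite ler_piMr ?invr_ge0 ?exprn_ge0//.
  by rewrite -expR0 ler_expR oppr_le0 divr_ge0 ?dot_ge0.
rewrite integral_cst//; apply: (@le_lt_trans _ _ (C%:E * 1)).
  by apply: lee_wpmul2l; [rewrite lee_fin invr_ge0 exprn_ge0|exact: probability_le1].
by rewrite mule1 ltry.
Qed.

(** An everywhere positive function with zero integral would force the whole space to be null. *)
Lemma out_density_gt0 y : (0 < out_density y)%R.
Proof.
rewrite -lte_fin out_densityE lt_neqAle integral_ge0 ?andbT//.
apply/eqP => I0.
have : \int[PU]_u `|(cond_density (u, y))%:E| = 0.
  by apply: (etrans _ (esym I0)); apply: eq_integral => u _; rewrite gee0_abs.
move=> /(ae_eq_integral_abs PU measurableT (mcond_u y)) [N [mN N0 sN]].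
have : PU [set: 'cV[R]_nt] = 1 by exact: probability_setT.
rewrite (_ : setT = N) ?N0; last first.
  apply/esym; rewrite -subTset => u _; apply: sN => /= /(_ I) /eqP.
  by rewrite eqe; apply/negP; exact: phi_neq0.
by move/eqP; rewrite eqe eq_sym oner_eq0.
Qed.

Lemma measurable_out_density : measurable_fun setT out_density.
Proof.
apply: (measurableT_comp (f := fine)) => //.
exact: (measurable_fun_fubini_tonelli_G (m1 := PU) (fun q => (cond_density q)%:E)
  mcond cond_density_ge0).
Qed.

Let k (y : 'cV[R]_nr) : \bar R := (out_density y)%:E * ((phi y)^-1)%:E.

Let k_ge0 y : 0 <= k y.
Proof. by rewrite mule_ge0// lee_fin ?invr_ge0 ?phi_ge0// ltW// out_density_gt0. Qed.

Let mk : measurable_fun setT k.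
Proof.
apply: emeasurable_funM; first by apply/measurable_EFinP; exact: measurable_out_density.
by apply/measurable_EFinP/measurable_phiV.
Qed.

Lemma ge0_integral_Y (g : 'cV[R]_nr -> \bar R) :
  measurable_fun setT g -> (forall y, 0 <= g y) ->
  \int[P]_w g (Y w) = leb (fun y => g y * (out_density y)%:E).
Proof.
move=> mg g0.
pose g' (q : V) := g q.2.
have mg' : measurable_fun setT g' by exact: (measurableT_comp mg measurable_snd).
have g'0 q : 0 <= g' q by exact: g0.
pose h q := g' q * (cond_density q)%:E * ((phi q.2)^-1)%:E.
have mh : measurable_fun setT h.
  by apply: emeasurable_funM => //; exact: emeasurable_funM.
have h0 q : 0 <= h q by rewrite !mule_ge0// lee_fin ?invr_ge0 phi_ge0.
transitivity (\int[P]_w g' (U w, Y w)); first by [].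
rewrite (ge0_integral_UY mg' g'0).
rewrite (fubini_tonelli2 (m1 := PU) (m2 := gam nr) h mh h0).
apply: eq_integral => y _; rewrite /fubini_G /h /g'/=.
rewrite ge0_integralZr//; last 3 first.
- exact: emeasurable_funM.
- by move=> u _; rewrite mule_ge0.
- by rewrite lee_fin invr_ge0 phi_ge0.
by rewrite ge0_integralZl// out_densityE.
Qed.

Lemma ge0_integral_UxY (g : V -> \bar R) :
  measurable_fun setT g -> (forall q, 0 <= g q) ->
  \int[PU \x PY]_q g q =
  \int[PU \x gam nr]_q (g q * (out_density q.2)%:E * ((phi q.2)^-1)%:E).
Proof.
move=> mg g0.
pose h q := g q * (out_density q.2)%:E * ((phi q.2)^-1)%:E.
have mh : measurable_fun setT h.
  apply: emeasurable_funM => //; apply: emeasurable_funM => //.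
  apply/measurable_EFinP; apply: (measurableT_comp measurable_out_density).
  exact: measurable_snd.
have h0 q : 0 <= h q.
  by rewrite !mule_ge0// lee_fin ?invr_ge0 ?phi_ge0// ltW// out_density_gt0.
rewrite (fubini_tonelli1 (m1 := PU) (m2 := PY) g mg g0).
rewrite (fubini_tonelli1 (m1 := PU) (m2 := gam nr) h mh h0).
apply: eq_integral => u _; rewrite /fubini_F.
have mgu : measurable_fun setT (fun y => g (u, y)).
  exact: (measurableT_comp mg (measurable_pair1 u)).
rewrite ge0_integral_distribution//.
exact: (ge0_integral_Y mgu (fun=> g0 _)).
Qed.

Definition info_density (q : V) : R := (cond_density q / out_density q.2)%R.

Lemma info_density_gt0 q : (0 < info_density q)%R.
Proof. by rewrite divr_gt0 ?phi_gt0 ?out_density_gt0. Qed.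

Lemma measurable_info_density : measurable_fun setT info_density.
Proof.
(* The quotient is written as a product with [exp(- ln f)], valid because [f > 0], to obtain
   measurability by composition. *)
rewrite (_ : info_density = fun q => cond_density q * expR (- ln (out_density q.2)))%R.
  apply: measurable_funM; first exact: measurable_cond_density.
  apply: measurableT_comp => //; apply: measurableT_comp => //.
  apply: (measurableT_comp (@measurable_ln R)).
  by apply: (measurableT_comp measurable_out_density); exact: measurable_snd.
by apply/funext => q; rewrite expRN lnK// posrE out_density_gt0.
Qed.

(** Both sides become integrals against the law of [U] times [gam nr], where the output density
    cancels. *)
Lemma joint_density A : measurable A ->
  distribution P (rv_pair U Y) A = \int[PU \x PY]_(q in A) (info_density q)%:E.
Proof.
move=> mA.
have m1 : measurable_fun setT (fun q : V => (\1_A q)%:E : \bar R).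
  exact/measurable_EFinP/measurable_indic.
have mi : measurable_fun setT (fun q => (info_density q)%:E).
  by apply/measurable_EFinP; exact: measurable_info_density.
transitivity (\int[P]_w (\1_A (U w, Y w))%:E).
  transitivity (\int[distribution P (rv_pair U Y)]_q (\1_A q)%:E).
    by rewrite integral_indic// setIT.
  by apply: ge0_integral_distribution => // q; rewrite lee_fin.
have i0 (q : V) : 0 <= (\1_A q)%:E :> \bar R by rewrite lee_fin.
rewrite (ge0_integral_UY m1 i0).
transitivity (\int[PU \x PY]_q ((\1_A q)%:E * (info_density q)%:E)); last first.
  rewrite [RHS]integral_mkcond; apply: eq_integral => q _.
  by rewrite patchE indicE; case: (q \in A); rewrite ?mul1e ?mul0e.
have mg : measurable_fun setT (fun q => (\1_A q)%:E * (info_density q)%:E).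
  exact: emeasurable_funM.
have g0 q : 0 <= (\1_A q)%:E * (info_density q)%:E.
  by rewrite mule_ge0// lee_fin ltW// info_density_gt0.
rewrite (ge0_integral_UxY mg g0); apply: eq_integral => q _; congr (_ * _).
rewrite -muleA -[X in _ = _ * X]EFinM.
by rewrite /info_density divfK// gt_eqF// out_density_gt0.
Qed.

End channel_densities.

(** By monotonicity the preimage of the ray above [r] is the ray above [e^r]; nonpositive arguments
    are sent to [-oo] and lie outside both. *)
Lemma measurable_lne {R : realType} : measurable_fun setT (@lne R).
Proof.
move=> _; apply: (measurability _ (ErealGenOInfty.measurableE R)) => //.
move=> _ [_ [r ->] <-]; rewrite setTI.
rewrite (_ : _ @^-1` _ = `](expR r)%:E, +oo[%classic); first exact: emeasurable_itv.
have lneE x : (r%:E < lne x)%E = ((expR r)%:E < x)%E.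
  case: x => [x| |]//=; last by rewrite !ltry.
  case: ifPn => [x0|]; rewrite ?lte_fin.
    by apply/esym/negbTE; rewrite -leNgt (le_trans x0)// expR_ge0.
  by rewrite -ltNge => x0; rewrite -[in RHS](lnK x0) ltr_expR.
by apply/seteqP; split => x /=; rewrite !in_itv/= !andbT lneE.
Qed.

Section extended_integral.
Context {d : measure_display} {T : measurableType d} {R : realType}.
Local Open Scope ereal_scope.

(** Positive and negative parts are compared separately, because this is applied to the logarithm of
    the information density, whose integrability is not established. *)
Lemma le_integralT (mu : {measure set T -> \bar R}) (f g : T -> \bar R) :
  measurable_fun setT f -> measurable_fun setT g -> (forall x, f x <= g x) ->
  \int[mu]_x f x <= \int[mu]_x g x.
Proof.
move=> mf mg fg; rewrite integralE [leRHS]integralE; apply: leeB.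
  apply: ge0_le_integral => //; [exact: measurable_funepos..|].
  by move=> x _; apply: (funepos_le (D := setT)); rewrite ?inE.
apply: ge0_le_integral => //; [exact: measurable_funeneg..|].
by move=> x _; apply: (funeneg_le (D := setT)); rewrite ?inE.
Qed.

End extended_integral.

(** The Radon-Nikodym derivative equals [h] almost everywhere for [Q], hence also for [P] by
    domination, and the logarithm is integrated against [P]. *)
Lemma kl_divergence_density {R : realType} {d : measure_display}
    {T : measurableType d} (P Q : probability T R) (h : T -> R) :
  measurable_fun setT h -> (forall x, 0 < h x) ->
  (forall A, measurable A -> P A = \int[Q]_(x in A) (h x)%:E)%E ->
  (kl_divergence P Q = \int[P]_x (ln (h x) / ln 2)%:E)%E.
Proof.
move=> mh h0 PE.
have mhE : measurable_fun setT (fun x => (h x)%:E) by apply/measurable_EFinP.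
have dom : P `<< Q by exact: dominates_density mhE PE.
rewrite /kl_divergence asboolT//.
set F := Radon_Nikodym _ _.
have domc : charge_of_finite_measure P `<< Q by [].
have iF : Q.-integrable setT F by exact: Radon_Nikodym_integrable.
have mF : measurable_fun setT F by exact: measurable_int iF.
have aeF : ae_eq Q setT F (fun x => (h x)%:E).
  apply: integral_ae_eq => // E _ mE.
  by rewrite -(Radon_Nikodym_integral domc mE) -PE.
transitivity (\int[P]_x log2e (h x)%:E)%E.
  have mlog (g : T -> \bar R) : measurable_fun setT g ->
      measurable_fun setT (fun x => log2e (g x)).
    move=> mg; apply: emeasurable_funM => //.
    exact: (measurableT_comp measurable_lne).
  apply: ae_eq_integral => //; [exact: mlog..|].
  by apply: filterS (null_dominates_ae_eq measurableT dom aeF) => x /= -> .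
apply: eq_integral => x _.
by rewrite /log2e lne_EFin.
Qed.

(** * Bounding the mutual information by a substitute output density *)

Section mutual_information_bound.
Context {R : realType} {d : measure_display} {T : measurableType d}.
Context {nt nr : nat} (H : 'M[R]_(nr, nt)) (P : probability T R).
Context (U : {mfun T >-> 'cV[R]_nt}) (Z : {mfun T >-> 'cV[R]_nr}).
Hypothesis gZ : standard_gaussian P Z.
Hypothesis indUZ : independent_rv P U Z.
Local Open Scope ereal_scope.

Notation PU := (distribution P U).
Notation Y := (channel_output H U Z).
Notation PY := (distribution P Y).
Notation PUY := (distribution P (rv_pair U Y)).
Notation V := ('cV[R]_nt * 'cV[R]_nr)%type.

Lemma mutual_informationE :
  mutual_information P U Y = \int[PUY]_q (ln (info_density H P U q) / ln 2)%:E.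
Proof.
apply: kl_divergence_density.
- exact: measurable_info_density.
- exact: info_density_gt0.
- exact: joint_density.
Qed.

Lemma mutual_information_le (q : 'cV[R]_nr -> R) :
  measurable_fun setT q -> (forall y, (0 < q y)%R) -> leb (fun y => (q y)%:E) = 1 ->
  let h w := (ln (cond_density H (U w, Y w)) - ln (q (Y w)))%R in
  P.-integrable setT (fun w => (h w)%:E) ->
  mutual_information P U Y <= \int[P]_w (h w)%:E * ((ln 2)^-1)%:E.
Proof.
move=> mq q0 q1 h ih.
have ln2 : (0 < ln 2 :> R)%R by rewrite ln_gt0// ltr1n.
pose r (y : 'cV[R]_nr) := (q y / out_density H P U y)%R.
have r0 y : (0 < r y)%R by rewrite divr_gt0// out_density_gt0.
have mln k (V' : measurableType k) (f : V' -> R) : measurable_fun setT f ->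
    measurable_fun setT (fun x => ln (f x)).
  by move=> mf; exact: (measurableT_comp (@measurable_ln R)).
have mr : measurable_fun setT r.
  rewrite (_ : r = fun y => q y * expR (- ln (out_density H P U y)))%R.
    apply: measurable_funM => //; apply: measurableT_comp => //.
    apply: measurableT_comp => //; apply: mln; exact: measurable_out_density.
  by apply/funext => y; rewrite expRN lnK// posrE out_density_gt0.
(* The logarithm of the information density is [ln phi(y - H u) - ln q(y) + ln r(y)]; [G] replaces
   [ln r] by [r - 1]. *)
pose G (x : V) := ((ln (cond_density H x) - ln (q x.2) + (r x.2 - 1)) / ln 2)%R.
have mG : measurable_fun setT G.
  apply: measurable_funM => //; apply: measurable_funD; last first.
    apply: measurable_funB; last exact: measurable_cst.
    by apply: (measurableT_comp mr); exact: measurable_snd.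
  apply: measurable_funB; first by apply: mln; exact: measurable_cond_density.
  by apply: mln; apply: (measurableT_comp mq); exact: measurable_snd.
(* Integrating [q / f] against the density [f] of [Y] returns the total mass of [q], so the
   correction [r - 1] has mean zero. *)
have Ir : \int[P]_w (r (Y w))%:E = 1.
  rewrite (ge0_integral_Y H gZ indUZ (g := fun y => (r y)%:E)).
  - rewrite -q1; apply: eq_leb => y.
    by rewrite -EFinM /r divfK// gt_eqF// out_density_gt0.
  - exact/measurable_EFinP.
  - by move=> y; rewrite lee_fin ltW.
have ir : P.-integrable setT (fun w => (r (Y w))%:E).
  apply/integrableP; split.
    by apply/measurable_EFinP; apply: (measurableT_comp mr); exact: measurable_funPT.
  under eq_integral do rewrite gee0_abs ?lee_fin ?ltW//.
  by rewrite Ir ltry.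
have i1 : P.-integrable setT (fun w => (r (Y w) - 1)%:E).
  under eq_fun do rewrite EFinB.
  by apply: integrableB => //; exact: finite_measure_integrable_cst.
have iD : P.-integrable setT (fun w => (h w + (r (Y w) - 1))%:E).
  by under eq_fun do rewrite EFinD; exact: integrableD.
have GE w : (G (U w, Y w))%:E = (h w + (r (Y w) - 1))%:E * ((ln 2)^-1)%:E by [].
have iG : P.-integrable setT (fun w => (G (U w, Y w))%:E).
  by under eq_fun do rewrite GE; exact: integrableZr.
rewrite mutual_informationE; apply: (@le_trans _ _ (\int[PUY]_x (G x)%:E)).
  apply: le_integralT.
  - apply/measurable_EFinP; apply: measurable_funM => //; apply: mln.
    exact: measurable_info_density.
  - exact/measurable_EFinP.
  - move=> x; rewrite lee_fin ler_pM2r ?invr_gt0// /info_density.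
    rewrite ln_div ?posrE ?phi_gt0 ?out_density_gt0//.
    have : (ln (r x.2) <= r x.2 - 1)%R.
      have := @le_ln1Dx R (r x.2 - 1); rewrite addrCA subrr addr0; apply.
      by rewrite ltrBrDr addrC subrr.
    by rewrite /r ln_div ?posrE ?out_density_gt0//; lra.
rewrite integral_distribution//; last exact/measurable_EFinP.
under eq_integral do rewrite /= GE.
rewrite integralZr//; apply: lee_wpmul2r; first by rewrite lee_fin invr_ge0 ltW.
under eq_integral do rewrite EFinD.
rewrite integralD// -[leRHS]adde0; apply: leeD => //.
under eq_integral do rewrite EFinB.
rewrite integralB//; last exact: finite_measure_integrable_cst.
rewrite Ir integral_cst// mul1e [X in _ - X](_ : _ = 1) ?subee//.
exact: probability_setT.
Qed.

End mutual_information_bound.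

(** * The bound for the density proportional to [exp(-a |y|^p)] *)

Section capacity_bound.
Context {R : realType} {d : measure_display} {T : measurableType d}.
Context {nt nr : nat} (H : 'M[R]_(nr, nt)) (P : probability T R).
Context (U : {mfun T >-> 'cV[R]_nt}) (Z : {mfun T >-> 'cV[R]_nr}).
Hypothesis gZ : standard_gaussian P Z.
Hypothesis indUZ : independent_rv P U Z.
Hypothesis nr_gt0 : (0 < nr)%N.
Variables (p a M : R).
Hypotheses (p_gt0 : 0 < p) (a_gt0 : 0 < a).
Local Open Scope ereal_scope.

Notation Y := (channel_output H U Z).

(** The total mass of [exp(-a |y|^p)] as given by [leb_exp], with the volume of the unit ball made
    explicit. *)
Definition partition_function : R :=
  (Num.sqrt pi ^+ nr / Gamma (nr%:R / 2 + 1) * a `^ (- (nr%:R / p)) *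
   Gamma (nr%:R / p + 1))%R.

Let K := partition_function.

Let nr_div (x : R) : (0 < x)%R -> (1 < nr%:R / x + 1)%R.
Proof. by move=> x0; rewrite ltrDr divr_gt0// ltr0n. Qed.

Lemma partition_function_gt0 : (0 < K)%R.
Proof.
rewrite /K /partition_function !mulr_gt0 ?invr_gt0 ?powR_gt0 ?Gamma_gt0 ?nr_div//.
by rewrite exprn_gt0// sqrtr_gt0 pi_gt0.
Qed.

Definition gibbs_density (y : 'cV[R]_nr) : R := (expR (- (a * enorm y `^ p)) / K)%R.

Let menormp (d' : measure_display) (T' : measurableType d') (f : T' -> 'cV[R]_nr) :
  measurable_fun setT f -> measurable_fun setT (fun w => a * enorm (f w) `^ p)%R.
Proof.
move=> mf; apply: measurable_funM; first exact: measurable_cst.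
by apply: (measurableT_comp (measurable_powR p)); exact: measurable_enorm.
Qed.

Let mexp : measurable_fun setT (fun y : 'cV[R]_nr => expR (- (a * enorm y `^ p)))%R.
Proof.
apply: measurableT_comp => //; apply: measurableT_comp => //.
exact: (menormp (f := fun y => y)).
Qed.

Lemma measurable_gibbs_density : measurable_fun setT gibbs_density.
Proof. by apply: measurable_funM => //; exact: measurable_cst. Qed.

Lemma leb_gibbs_density : leb (fun y => (gibbs_density y)%:E) = 1.
Proof.
have K0 := partition_function_gt0.
have := leb_exp nr a_gt0 p_gt0.
rewrite ball_volumeE// egammaE ?nr_div// -!EFinM -/partition_function -/K => LK.
transitivity (\int[gam nr]_y ((K^-1)%:E * ((expR (- (a * enorm y `^ p)))%:E * ((phi y)^-1)%:E))).
  apply: eq_integral => y _; rewrite muleA; congr (_ * _).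
  by rewrite -EFinM mulrC.
rewrite ge0_integralZl.
- by rewrite [X in _ * X]LK -EFinM mulVf// gt_eqF.
- exact: measurableT.
- apply: (measurable_lebi (f := fun y => (expR (- (a * enorm y `^ p)))%:E)).
  exact/measurable_EFinP.
- by move=> y _; rewrite mule_ge0 ?lee_fin ?expR_ge0 ?invr_ge0 ?phi_ge0.
- by rewrite lee_fin invr_ge0 ltW.
Qed.

Hypothesis momentY : \int[P]_w (enorm (Y w) `^ p)%:E <= M%:E.

Lemma mutual_information_gibbs : mutual_information P U Y <=
  ((ln K - nr%:R * ln (Num.sqrt (2 * pi)) - nr%:R / 2 + a * M) / ln 2)%:E.
Proof.
have K0 := partition_function_gt0.
have ln2 : (0 < ln 2 :> R)%R by rewrite ln_gt0// ltr1n.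
have g0 y : (0 < gibbs_density y)%R by rewrite divr_gt0// expR_gt0.
have mY : measurable_fun setT Y by exact: measurable_funPT.
have mZ : measurable_fun setT Z by exact: measurable_funPT.
pose c : R := (ln K - nr%:R * ln (Num.sqrt (2 * pi)))%R.
pose e w : R := (a * enorm (Y w) `^ p)%R.
pose s w : R := (2^-1 * dot (Z w) (Z w))%R.
(* Since [Y - H U = Z], the logarithm splits into a constant, a multiple of [|Y|^p] and
   [-|Z|^2 / 2]. Upon integration the last term is at most [-n / 2]. *)
have hE w : (ln (cond_density H (U w, Y w)) - ln (gibbs_density (Y w)) = c + e w - s w)%R.
  rewrite /cond_density /= /channel_output addrAC subrr add0r.
  rewrite /gibbs_density /phi ln_div ?posrE ?expR_gt0// expRK.
  rewrite lnM ?posrE ?expR_gt0// ?invr_gt0 ?exprn_gt0 ?sqrt2pi_gt0//.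
  rewrite expRK lnV ?posrE ?exprn_gt0 ?sqrt2pi_gt0// lnXn ?sqrt2pi_gt0//.
  by rewrite /c /e /s -mulr_natl /channel_output; field.
have e0 w : 0 <= (e w)%:E by rewrite lee_fin mulr_ge0 ?powR_ge0// ltW.
have s0 w : 0 <= (s w)%:E by rewrite lee_fin mulr_ge0 ?dot_ge0.
have me : measurable_fun setT (fun w => (e w)%:E).
  by apply/measurable_EFinP; exact: menormp.
have mdot : measurable_fun setT (fun y : 'cV[R]_nr => (dot y y)%:E).
  exact/measurable_EFinP/measurable_dot.
have ms : measurable_fun setT (fun w => (s w)%:E).
  by apply/measurable_EFinP/measurable_funM => //; exact: measurable_dot.
have Ie : \int[P]_w (e w)%:E <= (a * M)%:E.
  rewrite /e; under eq_integral do rewrite EFinM.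
  rewrite ge0_integralZl//.
  - by rewrite EFinM; apply: lee_wpmul2l => //; rewrite lee_fin ltW.
  - apply/measurable_EFinP; apply: (measurableT_comp (measurable_powR p)).
    exact: measurable_enorm.
  - by move=> w _; rewrite lee_fin powR_ge0.
  - by rewrite lee_fin ltW.
have Is : \int[P]_w (s w)%:E = (2^-1)%:E * \int[gam nr]_y (dot y y)%:E.
  rewrite /s; under eq_integral do rewrite EFinM.
  rewrite ge0_integralZl//.
  - congr (_ * _); apply: (ge0_integral_gaussian gZ mdot) => y.
    by rewrite lee_fin dot_ge0.
  - by apply/measurable_EFinP; exact: measurable_dot.
  - by move=> w _; rewrite lee_fin dot_ge0.
have ie : P.-integrable setT (fun w => (e w)%:E).
  apply/integrableP; split => //; under eq_integral do rewrite gee0_abs//.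
  by rewrite (le_lt_trans Ie) ?ltry.
have isq : P.-integrable setT (fun w => (s w)%:E).
  apply/integrableP; split => //; under eq_integral do rewrite gee0_abs//.
  by rewrite Is lte_mul_pinfty// ?lee_fin// gaussian_moment2_lty.
have ic : P.-integrable setT (fun w => c%:E) by exact: finite_measure_integrable_cst.
have ice : P.-integrable setT (fun w => (c + e w)%:E).
  by under eq_fun do rewrite EFinD; exact: integrableD.
have ih : P.-integrable setT
    (fun w => (ln (cond_density H (U w, Y w)) - ln (gibbs_density (Y w)))%:E).
  under eq_fun do rewrite hE EFinB.
  exact: integrableB.
apply: (le_trans (mutual_information_le gZ indUZ measurable_gibbs_density g0
  leb_gibbs_density ih)).
rewrite [leRHS]EFinM; apply: lee_wpmul2r; first by rewrite lee_fin invr_ge0 ltW.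
under eq_integral do rewrite hE EFinB.
rewrite integralB//.
under eq_integral do rewrite EFinD.
have Ic : \int[P]_w c%:E = c%:E.
  rewrite (integral_cst _ measurableT) -[RHS]mule1; congr (_ * _).
  exact: probability_setT.
rewrite integralD// Ic Is.
have -> : (ln K - nr%:R * ln (Num.sqrt (2 * pi)) - nr%:R / 2 + a * M =
    c + a * M - 2^-1 * nr%:R)%R by rewrite /c; field.
rewrite [leRHS]EFinB [X in _ <= X - _]EFinD; apply: leeB; first exact: leeD.
by rewrite EFinM; apply: lee_wpmul2l; [rewrite lee_fin|exact: gaussian_moment2_ge].
Qed.

End capacity_bound.

(** * The maximal norm over the image of the input set *)

Section maximal_norm.
Context {R : realType}.

Lemma enorm_le_sum n (x : 'cV[R]_n) : enorm x <= \sum_i `|x i ord0|.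
Proof.
rewrite -[leRHS]ger0_norm ?sumr_ge0// -sqrtr_sqr enormE ler_sqrt ?sqr_ge0//.
rewrite expr2 mulr_suml; apply: ler_sum => i _.
apply: (le_trans (ler_norm _)); rewrite normrM ler_wpM2l//.
by rewrite (bigD1 i)//= lerDl sumr_ge0.
Qed.

(** [rmax] is an infimum over admissible radii; boundedness of the image makes that set nonempty. *)
Lemma compact_enorm_bounded nt nr (X : set 'cV[R]_nt) (H : 'M[R]_(nr, nt)) :
  compact X -> exists B, forall x, X x -> enorm (H *m x) <= B.
Proof.
move=> /compact_bounded [B0 [_ XB]].
have {}XB x : X x -> `|x| <= B0 + 1 by apply: XB; rewrite ltrDl.
exists (\sum_i \sum_k `|H i k| * (B0 + 1)) => x /XB xB.
apply: (le_trans (enorm_le_sum _)); apply: ler_sum => i _.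
rewrite mxE (le_trans (ler_norm_sum _ _ _))//; apply: ler_sum => k _.
rewrite normrM ler_wpM2l// (le_trans _ xB)//.
rewrite [leRHS]mx_normrE.
exact: (le_bigmax _ (fun ij : 'I_nt * 'I_1 => `|x ij.1 ij.2|) (k, ord0)).
Qed.

Lemma enorm_le_rmax n (S : set 'cV[R]_n) (y : 'cV[R]_n) :
  (exists B, forall x, S x -> enorm x <= B) -> S y -> enorm y <= rmax S.
Proof.
move=> [B SB] Sy; apply: lb_le_inf.
  exists B; split; last by move=> x /SB.
  by rewrite (le_trans (enorm_ge0 y))// SB.
by move=> r [_ Sr]; exact: Sr.
Qed.

End maximal_norm.

(** The bound is asked only at values taken by [U], as only these are known to lie in the input
    set. *)
Lemma ge0_integral_distribution_le {R : realType} d d' (T : measurableType d)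
    (T' : measurableType d') (P : probability T R) (U : {mfun T >-> T'})
    (f : T' -> \bar R) (m : \bar R) :
  measurable_fun setT f -> (forall u, 0 <= f u)%E -> (0 <= m)%E ->
  (forall w, f (U w) <= m)%E -> (\int[distribution P U]_u f u <= m)%E.
Proof.
move=> mf f0 m0 fm; rewrite ge0_integral_distribution//.
apply: (@le_trans _ _ (\int[P]_w (cst m : T -> \bar R) w)%E).
  apply: ge0_le_integral => //; first by move=> w _; exact: f0.
    exact: (measurableT_comp mf).
  by move=> w _; exact: fm.
rewrite integral_cst// -[leRHS]mule1; apply: lee_wpmul2l => //.
exact: probability_le1.
Qed.

(** * The optimal scale [a] and the resulting constant *)

Section optimal_scale.
Context {R : realType}.
Local Open Scope ereal_scope.

(** By monotonicity the center 0 is the worst case. There a vanishing moment would give [z = 0]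
    almost surely, against [E|Z|^2 >= n > 0]. *)
Lemma gaussian_moment_gt0 n (x : 'cV[R]_n) (p : R) : (0 < n)%N -> (0 < p)%R ->
  0 < \int[gam n]_z (enorm (x + z) `^ p)%:E.
Proof.
move=> n0 p0.
have F0 (y : 'cV[R]_n) : 0 <= (enorm (0 + y) `^ p)%:E by rewrite lee_fin powR_ge0.
apply: (@lt_le_trans _ _ (\int[gam n]_z (enorm (0 + z) `^ p)%:E)); last first.
  apply: le_gaussian_moment => //.
  by rewrite (_ : dot 0 0 = 0%R) ?dot_ge0// /dot big1// => i _; rewrite mxE mul0r.
have mF : measurable_fun setT (fun y : 'cV[R]_n => (enorm (0 + y) `^ p)%:E).
  apply/measurable_EFinP; apply: (measurableT_comp (measurable_powR p)).
  by apply: measurable_enorm; exact: measurable_vadd.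
rewrite lt_neqAle integral_ge0 ?andbT//; apply/eqP => I0.
have : \int[gam n]_z `|(enorm (0 + z) `^ p)%:E| = 0.
  by apply: (etrans _ (esym I0)); apply: eq_integral => z _; rewrite gee0_abs.
move=> /(ae_eq_integral_abs _ measurableT mF) ae0.
have md : measurable_fun setT (fun y : 'cV[R]_n => (dot y y)%:E).
  exact/measurable_EFinP/measurable_dot.
have := gaussian_moment2_ge (R := R) n.
rewrite (ge0_ae_eq_integral (g := cst 0) measurableT md)//.
- by rewrite integral0 lee_fin leNgt ltr0n n0.
- by move=> y _; rewrite lee_fin dot_ge0.
apply: filterS ae0 => z /= + _ => /(_ I) /eqP.
rewrite eqe powR_eq0 add0r enormE => /andP[+ _].
by rewrite sqrtr_eq0 => z0; apply/eqP; rewrite eqe eq_le z0 dot_ge0.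
Qed.

Lemma kconst_gt0 n p : (0 < n)%N -> (0 < p)%R -> (0 < kconst n p :> R)%R.
Proof.
move=> n0 p0; have n0' : (0 < n%:R :> R)%R by rewrite ltr0n.
rewrite /kconst divr_gt0 ?powR_gt0 ?Gamma_gt0 ?ltrDr ?divr_gt0//.
by rewrite !mulr_gt0 ?sqrtr_gt0 ?pi_gt0 ?expR_gt0 ?powR_gt0 ?divr_gt0 ?Gamma_gt0 ?ltrDr ?divr_gt0.
Qed.

(* [a = n / (p M)] minimizes the bound of [mutual_information_gibbs]. *)
Lemma ln_partition_function n p (M : R) : (0 < n)%N -> (0 < p)%R -> (0 < M)%R ->
  (ln (@partition_function R n p (n%:R / (p * M))) - n%:R * ln (Num.sqrt (2 * pi))
     - n%:R / 2 + n%:R / (p * M) * M =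
   n%:R * ln (kconst n p / (2 * pi * expR 1) `^ 2^-1 * n%:R `^ p^-1 *
     (n%:R^-1 * M) `^ p^-1))%R.
Proof.
move=> n0 p0 M0; have n0' : (0 < n%:R :> R)%R by rewrite ltr0n.
have G1 : (0 < Gamma (n%:R / p + 1) :> R)%R by rewrite Gamma_gt0 ?ltrDr ?divr_gt0.
have G2 : (0 < Gamma (n%:R / 2 + 1) :> R)%R by rewrite Gamma_gt0 ?ltrDr ?divr_gt0.
have pi0 := pi_gt0 R.
have k0 := kconst_gt0 n0 p0.
have a0 : (0 < n%:R / (p * M))%R by rewrite divr_gt0 ?mulr_gt0.
have s0 : (0 < Num.sqrt pi :> R)%R by rewrite sqrtr_gt0.
have e0 : (0 < 2 * pi * expR 1 :> R)%R by rewrite !mulr_gt0 ?expR_gt0.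
have p1 (x y : R) : (0 < x)%R -> (0 < x `^ y)%R by exact: powR_gt0.
have lnM' (x y : R) : (0 < x)%R -> (0 < y)%R -> (ln (x * y) = ln x + ln y)%R.
  by move=> x0 y0; rewrite lnM.
have ln_div' (x y : R) : (0 < x)%R -> (0 < y)%R -> (ln (x / y) = ln x - ln y)%R.
  by move=> x0 y0; rewrite ln_div.
have M' (x y : R) : (0 < x)%R -> (0 < y)%R -> (0 < x * y)%R by exact: mulr_gt0.
have D' (x y : R) : (0 < x)%R -> (0 < y)%R -> (0 < x / y)%R by exact: divr_gt0.
have E1 : (ln (@partition_function R n p (n%:R / (p * M))) =
    n%:R * ln (Num.sqrt pi) - ln (Gamma (n%:R / 2 + 1))
    - n%:R / p * (ln n%:R - (ln p + ln M)) + ln (Gamma (n%:R / p + 1)))%R.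
  rewrite /partition_function; move: (Gamma _) (Gamma _) (Num.sqrt pi) G1 G2 s0.
  move=> g1 g2 s G1 G2 s0; have sn : (0 < s ^+ n)%R by exact: exprn_gt0.
  rewrite (lnM' _ _ (M' _ _ (D' _ _ sn G2) (p1 _ _ a0)) G1).
  rewrite (lnM' _ _ (D' _ _ sn G2) (p1 _ _ a0)) (ln_div' _ _ sn G2) lnXn//.
  rewrite ln_powR (ln_div' _ _ n0' (M' _ _ p0 M0)) (lnM' _ _ p0 M0).
  by rewrite mulNr -(mulr_natl (ln s)).
have E2 : (ln (kconst n p / (2 * pi * expR 1) `^ 2^-1 * n%:R `^ p^-1 *
     (n%:R^-1 * M) `^ p^-1) =
   ln (kconst n p) - 2^-1 * (ln (2 * pi) + 1) + p^-1 * ln n%:R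
   + p^-1 * (ln M - ln n%:R))%R.
  move: (kconst n p) k0 => k k0; have npi : (0 < 2 * pi :> R)%R by exact: M'.
  have nM : (0 < n%:R^-1 * M)%R by rewrite mulr_gt0 ?invr_gt0.
  rewrite (lnM' _ _ (M' _ _ (D' _ _ k0 (p1 _ _ e0)) (p1 _ _ n0')) (p1 _ _ nM)).
  rewrite (lnM' _ _ (D' _ _ k0 (p1 _ _ e0)) (p1 _ _ n0')) (ln_div' _ _ k0 (p1 _ _ e0)).
  rewrite !ln_powR (lnM' _ _ npi (expR_gt0 1)) expRK.
  by rewrite (mulrC n%:R^-1%R) (ln_div' _ _ M0 n0').
have E3 : (ln (kconst n p) = ln (Num.sqrt pi) + p^-1 + p^-1 * (ln p - ln n%:R)
    + n%:R^-1 * ln (Gamma (n%:R / p + 1)) - n%:R^-1 * ln (Gamma (n%:R / 2 + 1)) :> R)%R.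
  rewrite /kconst; move: (Gamma _) (Gamma _) (Num.sqrt pi) G1 G2 s0.
  move=> g1 g2 s G1 G2 s0; have s1 := M' _ _ s0 (expR_gt0 p^-1%R).
  have s2 := M' _ _ s1 (p1 _ p^-1%R (D' _ _ p0 n0')).
  rewrite (ln_div' _ _ (M' _ _ s2 (p1 _ _ G1)) (p1 _ _ G2)) (lnM' _ _ s2 (p1 _ _ G1)).
  rewrite (lnM' _ _ s1 (p1 _ _ (D' _ _ p0 n0'))) (lnM' _ _ s0 (expR_gt0 _)).
  by rewrite !ln_powR expRK (ln_div' _ _ p0 n0').
have E4 : (ln (Num.sqrt (2 * pi)) = 2^-1 * ln (2 * pi) :> R)%R.
  by rewrite -powR12_sqrt ?ln_powR// mulr_ge0// ltW.
rewrite E1 E2 E3 E4.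
(* With every logarithm expanded, the claim is a rational identity in [N], [p], [M] and the
   logarithms, which can be treated as independent variables. *)
move: (ln (Num.sqrt pi)) (ln (2 * pi)) (ln p) (ln M) (ln (Gamma (n%:R / p + 1)))
  (ln (Gamma (n%:R / 2 + 1))) (ln n%:R) => x1 x2 x3 x4 x5 x6 x7.
move: (n%:R : R) n0' => N N0; clear - N0 p0 M0.
by field; rewrite !gt_eqF.
Qed.

Lemma log2e_EFin (x : R) : (0 < x)%R -> log2e x%:E = (ln x / ln 2)%:E.
Proof. by move=> x0; rewrite /log2e lne_EFin. Qed.

End optimal_scale.

Unset Implicit Arguments.
Set Strict Implicit.
Set Printing Implicit Defensive.

Theorem theorem1 (R : realType) (nt nr : nat) (hnt : (0 < nt)%N)
    (hnr : (0 < nr)%N) (X : set 'cV[R]_nt) (Xconvex : convex_set X)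
    (Xcompact : compact X) (X0 : X 0) (H : 'M[R]_(nr, nt))
    (d : measure_display) (T : measurableType d) (P : probability T R)
    (Z : {mfun T >-> 'cV[R]_nr}) (Zgauss : standard_gaussian P Z)
    (xt : 'cV[R]_nr) (xtHX : [set H *m x | x in X] xt)
    (xtmax : enorm xt = rmax [set H *m x | x in X]) :
  (capacity X H <= moment_bound P (fun w => (xt + Z w)%R))%E.
Proof.
apply: ge_ereal_sup => _ [d' [T' [P' [U [Z' [XU gZ' indUZ ->]]]]]].
apply: le_ereal_inf_tmp => _ [p /= p0 <-].
have ln2 : 0 < ln 2 :> R by rewrite ln_gt0// ltr1n.
have nr0 : 0 < nr%:R :> R by rewrite ltr0n.
have mp x : measurable_fun setT (fun y : 'cV[R]_nr => (enorm (x + y) `^ p)%:E).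
  apply/measurable_EFinP; apply: (measurableT_comp (measurable_powR p)).
  by apply: measurable_enorm; exact: measurable_vadd.
have ep0 x (y : 'cV[R]_nr) : (0 <= (enorm (x + y) `^ p)%:E)%E.
  by rewrite lee_fin powR_ge0.
pose m := (\int[gam nr]_z (enorm (xt + z) `^ p)%:E)%E.
have EZ : ('E_P[fun w => (enorm (xt + Z w) `^ p)%R] = m)%E.
  by rewrite unlock; exact: (ge0_integral_gaussian Zgauss (mp xt) (ep0 xt)).
have xt_max x : X x -> dot (H *m x) (H *m x) <= dot xt xt.
  move=> Xx; rewrite -ler_sqrt ?dot_ge0// -!enormE xtmax; apply: enorm_le_rmax.
    have [B XB] := compact_enorm_bounded H Xcompact.
    by exists B => _ [y Xy <-]; exact: XB.
  by exists x.
(* Conditionally on the input, the output is a Gaussian centered at a point no longer than [xt];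
   average the monotonicity of the moment over the input. *)
have EY : (\int[P']_w (enorm (channel_output H U Z' w) `^ p)%:E <= m)%E.
  pose g (q : 'cV[R]_nt * 'cV[R]_nr) := (enorm (H *m q.1 + q.2) `^ p)%:E.
  have mg : measurable_fun setT g.
    apply/measurable_EFinP; apply: (measurableT_comp (measurable_powR p)).
    apply: measurable_enorm; apply: measurable_vadd; last exact: measurable_snd.
    by apply: measurable_vmul; exact: measurable_fst.
  have g0 q : (0 <= g q)%E by rewrite lee_fin powR_ge0.
  have -> : (\int[P']_w (enorm (channel_output H U Z' w) `^ p)%:E =
      \int[P']_w g (U w, Z' w))%E by [].
  rewrite (ge0_integral_UZ gZ' indUZ mg g0).
  rewrite (fubini_tonelli1 (m1 := distribution P' U) (m2 := gam nr) g mg g0).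
  apply: ge0_integral_distribution_le.
  - exact: (measurable_fun_fubini_tonelli_F (m2 := gam nr) g mg g0).
  - by move=> u; exact: integral_ge0.
  - by apply: integral_ge0 => z _; exact: ep0.
  - by move=> w; exact: (le_gaussian_moment p0 (xt_max _ (XU w))).
(* Needed for [n / (p M)] to be a positive scale and for the logarithm of the bound to be finite
   when the moment is. *)
have m0 : (0 < m)%E by exact: gaussian_moment_gt0.
have k0 : 0 < kconst nr p / (2 * pi * expR 1) `^ 2^-1 * nr%:R `^ p^-1 :> R.
  by rewrite mulr_gt0 ?powR_gt0// divr_gt0 ?kconst_gt0// powR_gt0// !mulr_gt0 ?pi_gt0 ?expR_gt0.
rewrite /moment_norm EZ; move: m0 EY; move: m {EZ} => m.
case: m => [M| |]//; rewrite ?lte_fin => M0 EY.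
  rewrite -(EFinM nr%:R^-1) poweR_EFin -EFinM log2e_EFin; last first.
    by rewrite mulr_gt0// powR_gt0// mulr_gt0// invr_gt0.
  have a0 : 0 < nr%:R / (p * M) :> R by rewrite divr_gt0// mulr_gt0.
  apply: (le_trans (mutual_information_gibbs gZ' indUZ hnr p0 a0 EY)).
  by rewrite ln_partition_function// -EFinM mulrA.
(* An infinite moment makes the right-hand side infinite. *)
rewrite gt0_muley ?lte_fin ?invr_gt0// poweRyr ?invr_neq0 ?gt_eqF//.
by rewrite gt0_muley ?lte_fin// /log2e /= gt0_mulye ?lte_fin ?invr_gt0// gt0_muley ?lte_fin// leey.
Qed.
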